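(* Let $T$ be a locally countable acyclic Borel graph on a standard Borel space $X$, and let $\mathscr C$ be an $E_T$-invariant measure class of Borel probability measures on $X$. Let $\mu$ and $\nu$ be probability measures in $\mathscr C$ and let $\rho_\mu$ and $\rho_\nu$ be their associated Radon--Nikodym cocycles on $E_T$. Then, after discarding a null set, we have: (a) An end $\xi$ of $T$ is $\rho_\mu$-nonvanishing if and only if $\xi$ is $\rho_\nu$-nonvanishing. (b) An end $\xi$ of $T$ is $\rho_\mu$-barytropic if and only if $\xi$ is $\rho_\nu$-barytropic. (c) $\mathrm{Core}_\mu(T)=\mathrm{Core}_\nu(T)$.
   Context: A graph on $X$ is an irreflexive symmetric subset of $X^2$; locally countable means each vertex has countably many neighbors. $E_T$ is the connectedness equivalence relation of $T$. A measure class is a class of mutually absolutely continuous measures; it is $E_T$-invariant if $E_T$ is measure-class-preserving (mcp) for its members, i.e. the $E_T$-saturation of every null set is null. ''After discarding a null set'' means: on the complement of some $E_T$-invariant Borel null set. For an mcp countable Borel equivalence relation $E$ on $(X,\mu)$, the Radon--Nikodym cocycle $\rho=\rho_\mu$ is the (unique up to null sets) Borel $\rho:E\to(0,\infty)$ with $\rho(z,y)\rho(y,x)=\rho(z,x)$ and, writing $\rho^x(y):=\rho(y,x)$, $\int_X\sum_{y\in[x]_E}h(x,y)\,d\mu(x)=\int_X\sum_{y\in[x]_E}h(y,x)\rho^x(y)\,d\mu(x)$ for all Borel $h:E\to[0,\infty]$. A set $D\subseteq[x]_E$ is $\rho$-infinite if $\sum_{y\in D}\rho^x(y)=\infty$ (independent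 of $x$ in the class), otherwise $\rho$-finite. A geodesic ray is an injective infinite path in $T$; ends are classes of rays modulo having a common tail, and $\partial_TX$ is the set of ends. A half-space is a $T$-connected set $U\subseteq X$ with exactly one edge joining $U$ to $X\setminus U$; its closure $\overline U$ is $U$ together with all ends represented by rays in $U$. Vertices $y$ converge to an end $\xi$ if they are eventually in every half-space $U$ with $\xi\in\overline U$. An end $\xi$ of $[x]_{E_T}$ is $\rho$-vanishing if $\limsup_{y\to\xi}\rho^x(y)=0$, and $\rho$-nonvanishing otherwise; it is $\rho$-barytropic if every half-space $U$ with $\xi\in\overline U$ is $\rho$-infinite. $\mathrm{Core}_\mu(T)$ is the set of all $z\in X\cup\partial_TX$ such that every half-space $U$ of $T$ with $z\in\overline U$ is $\rho_\mu$-infinite. *)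

(* Defs.v *)
From HB Require Import structures.
From mathcomp Require Import all_boot all_order all_algebra.
From mathcomp Require Import all_classical all_reals all_analysis.
From mathcomp Require Import measurable_realfun.

Set Implicit Arguments.
Unset Strict Implicit.
Unset Printing Implicit Defensive.

Import Order.TTheory GRing.Theory Num.Theory.
Import numFieldNormedType.Exports.

Local Open Scope classical_set_scope.
Local Open Scope ring_scope.

Definition polish (R : realType) (P : metricType R) : Prop :=
  (exists2 D : set P, countable D & dense D) /\
  (forall F : set_system P, ProperFilter F -> cauchy F -> exists x : P, F --> x).

Definition standard_borel (R : realType) (d : measure_display)
    (X : measurableType d) : Prop :=
  exists (P : metricType R) (f : X -> P),
    [/\ polish P, bijective f &
        forall A : set X, measurable A <-> <<s [set U : set P | open U] >> (f @` A)].

Definition adj (X : choiceType) (T : set (X * X)) : rel X :=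
  fun x y => (x, y) \in T.

Definition is_graph (X : choiceType) (T : set (X * X)) : Prop :=
  (forall x, ~ T (x, x)) /\ (forall x y, T (x, y) -> T (y, x)).

Definition locally_countable (X : choiceType) (T : set (X * X)) : Prop :=
  forall x, countable [set y | T (x, y)].

(* [:: x; y] is always a [ucycle] of adjacent vertices x, y; genuine cycles
   have at least three vertices. *)
Definition acyclic (X : choiceType) (T : set (X * X)) : Prop :=
  forall s : seq X, ucycle (adj T) s -> (size s <= 2)%N.

Definition conn_rel (X : choiceType) (T : set (X * X)) : set (X * X) :=
  [set p | exists s : seq X, path (adj T) p.1 s /\ last p.1 s = p.2].

Definition eclass (X : choiceType) (E : set (X * X)) (x : X) : set X :=
  [set y | E (x, y)].

Definition saturation (X : choiceType) (E : set (X * X)) (A : set X) : set X :=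
  \bigcup_(x in A) eclass E x.

Definition measure_class (R : realType) (d : measure_display)
    (X : measurableType d) (C : set (probability X R)) : Prop :=
  forall mu nu : probability X R, C mu -> C nu -> mu `<< nu.

Definition mcp (R : realType) (d : measure_display) (X : measurableType d)
    (E : set (X * X)) (mu : probability X R) : Prop :=
  forall A : set X, mu.-negligible A -> mu.-negligible (saturation E A).

(* [measurable_fun D f] alone holds vacuously when D is not measurable. *)
Definition borel_on (d d' : measure_display) (Y : measurableType d)
    (Z : measurableType d') (D : set Y) (f : Y -> Z) : Prop :=
  measurable D /\ measurable_fun D f.

(* A function on E is a total function on X * X of which only the restriction
   to E matters; rho^x(y) is [rho (y, x)]. *)
Definition RN_cocycle (R : realType) (d : measure_display)
    (X : measurableType d) (E : set (X * X)) (mu : probability X R)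
    (rho : X * X -> R) : Prop :=
  [/\ borel_on E rho,
      forall p, E p -> 0 < rho p,
      forall x y z, E (x, y) -> E (y, z) -> rho (z, y) * rho (y, x) = rho (z, x) &
      forall h : X * X -> \bar R,
        borel_on E h -> (forall p, E p -> (0 <= h p)%E) ->
        (\int[mu]_x (\esum_(y in eclass E x) h (x, y)) =
         \int[mu]_x (\esum_(y in eclass E x) (h (y, x) * (rho (y, x))%:E)))%E].

(* For D contained in one class; by the cocycle identity the choice of the base
   point x in that class is immaterial. *)
Definition rho_infinite (R : realType) (X : choiceType) (E : set (X * X))
    (rho : X * X -> R) (D : set X) : Prop :=
  exists2 x, D `<=` eclass E x & (\esum_(y in D) (rho (y, x))%:E = +oo)%E.

Definition geodesic_ray (X : choiceType) (T : set (X * X)) (r : nat -> X) : Prop :=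
  injective r /\ forall n, T (r n, r n.+1).

Definition common_tail (X : choiceType) (r s : nat -> X) : Prop :=
  exists m n, forall k, r (m + k)%N = s (n + k)%N.

Definition graph_end (X : choiceType) (T : set (X * X)) : Type :=
  {xi : set (nat -> X) | exists2 r, geodesic_ray T r &
     xi = [set s | geodesic_ray T s /\ common_tail r s]}.

Definition induced (X : choiceType) (T : set (X * X)) (U : set X) : set (X * X) :=
  T `&` (U `*` U).

Definition half_space (X : choiceType) (T : set (X * X)) (U : set X) : Prop :=
  (forall x y, U x -> U y -> conn_rel (induced T U) (x, y)) /\
  (exists! e : X * X, [/\ T e, U e.1 & ~ U e.2]).

Definition end_closure (X : choiceType) (T : set (X * X)) (U : set X) :
    set (X + graph_end T) :=
  [set z | match z with
           | inl x => U x
           | inr xi => exists2 r, sval xi r & range r `<=` U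
           end].
Arguments end_closure {X} T U _.

Definition end_nbhs (X : choiceType) (T : set (X * X)) (xi : graph_end T) :
    set_system X :=
  filter_from
    (finI_from [set U | half_space T U /\ end_closure T U (inr xi)] id) id.

(* This is [limf_esup], which the library states for [filteredType] domains only.
   As for [rho_infinite], the base point x of the class does not matter. *)
Definition rho_vanishing (R : realType) (X : choiceType) (T : set (X * X))
    (rho : X * X -> R) (xi : graph_end T) : Prop :=
  exists2 x, end_closure T (eclass (conn_rel T) x) (inr xi) &
    ereal_inf [set ereal_sup [set (rho (y, x))%:E | y in V]
                 | V in end_nbhs xi] = 0%E.

Definition rho_nonvanishing (R : realType) (X : choiceType) (T : set (X * X))
    (rho : X * X -> R) (xi : graph_end T) : Prop :=
  ~ rho_vanishing rho xi.

Definition rho_barytropic (R : realType) (X : choiceType) (T : set (X * X))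
    (rho : X * X -> R) (xi : graph_end T) : Prop :=
  forall U, half_space T U -> end_closure T U (inr xi) ->
    rho_infinite (conn_rel T) rho U.

Definition core (R : realType) (X : choiceType) (T : set (X * X))
    (rho : X * X -> R) : set (X + graph_end T) :=
  [set z | forall U, half_space T U -> end_closure T U z ->
     rho_infinite (conn_rel T) rho U].
Arguments core {R X} T rho _.

(* Main.v *)
Require Import Defs.
From HB Require Import structures.
From mathcomp Require Import all_boot all_order all_algebra.
From mathcomp Require Import all_classical all_reals all_analysis.
From mathcomp Require Import measurable_realfun.
From mathcomp Require Import zify lra.

Set Implicit Arguments.
Unset Strict Implicit.
Unset Printing Implicit Defensive.

Import Order.TTheory GRing.Theory Num.Theory.
Import numFieldNormedType.Exports.

Local Open Scope classical_set_scope.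
Local Open Scope ring_scope.

(** Let [side x y] be the set of vertices that stay connected to [x] once its
neighbour [y] is removed. In an acyclic graph the half-spaces are the sides of
the directed edges, so each claim says that smallness of sides passes from
[rho_mu] to [rho_nu], for all half-spaces (or ends) of a class at once; the two
measures play symmetric roles, so one direction is enough.

The difficulty is that a class may have uncountably many ends, which cannot in
general be chosen in a Borel way. It disappears for the following reason. Call
a side small in a sense that is inherited by subsets and by unions of two sets, and
that fails for the whole class. Two sides of edges leaving the same vertex
cover the class, so at most one of them is small. Hence the edges with a small
side form the graph of a Borel partial function [g], and every small side is a
backward orbit of [g] ([flow_side]). Now only forward orbits matter, and these
are sequences: a sum over the points behind [x], integrated over [x], is by
mass transport a sum along the forward orbit of a point, integrated over that
point.

For barytropic ends and the core, small means of finite [rho_mu]-mass, and the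
argument is the Hopf decomposition of [g] ([upsum_finite]). Let V_k be the set
of the points with at most [k] mass behind them. The transport for [mu] shows
that almost every forward orbit meets V_k only finitely often. Sorting the
points of V_k by the number of visits still to come gives sets that a forward
orbit meets at most once, and the transport for [nu] then bounds the integral
over such a set of the [rho_nu]-mass behind a point. Classes of finite total
mass, where every side has finite mass, are treated by normalizing the mass
([class_mass_finite]).

For nonvanishing ends, small means that the supremum of [rho_mu] over the side
is smaller than over the class. Seen from a fixed point, the suprema over the
sides behind the points of its forward orbit increase, so their increments
telescope ([flux_telescopes]). Transporting these increments, compared with the
integrable density F = dnu/dmu, shows that behind almost every edge at which
the supremum really increases, [rho_nu] exceeds a given positive bound only
finitely often ([fall_finite]). On the way to a [rho_mu]-vanishing end the
suprema tend to zero, so such an edge exists ([vanishing_falls]), and beyond it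
[rho_nu] vanishes towards the end as well. That [rho_nu] is [rho_mu] multiplied
by the coboundary of F is [cocycle_change].

Mass transport needs Borel functions that enumerate the classes. They are
provided almost everywhere by [standard_borel_enumeration], a form of the
Lusin-Novikov theorem that allows a null set to be discarded. This makes its
proof short: one exhausts the part that Borel graphs can cover, uses that
projections of Souslin schemes are measurable, and shows that over almost every
point the rest would be a nonempty complete set in which no point of the
countable section can be isolated, which is impossible. *)

(** * Exhaustion and measurable hulls *)

Section null_sets.
Context (R : realType) (d : measure_display) (X : measurableType d).
Variable mu : probability X R.

(** A class of measurable sets stable under countable unions has a member that
    contains all others up to null sets: take the union of members whose
    measures approach the supremum. *)
Lemma exhaustion (C : set (set X)) : C set0 ->
  (forall A, C A -> measurable A) ->
  (forall A : (set X)^nat, (forall n, C (A n)) -> C (\bigcup_n A n)) ->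
  exists2 W, C W & forall A, C A -> mu (A `\` W) = 0%E.
Proof.
move=> C0 mC CU; pose S := [set mu A | A in C].
have S1 : ubound S 1%E by move=> _ [A CA <-]; exact: probability_le1 (mC _ CA).
have fS : ereal_sup S \is a fin_num.
  rewrite ge0_fin_numE; first by apply: le_lt_trans (ltry 1); exact: ge_ereal_sup.
  by apply: ereal_sup_ubound; exists set0 => //; rewrite measure0.
have approx n : exists A, C A /\ (ereal_sup S - (n.+1%:R^-1)%:E < mu A)%E.
  have [_ [A CA <-] h] := ub_ereal_sup_adherent (ltac:(by []) : 0 < n.+1%:R^-1 :> R) fS.
  by exists A.
have [A HA] := choice approx.
have CW : C (\bigcup_n A n) by apply: CU => n; case: (HA n).
exists (\bigcup_n A n) => // B CB.
have mW := mC _ CW; have mB := mC _ CB.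
have CBW : C (\bigcup_n (if n == 0%N then B else \bigcup_n A n)).
  by apply: (CU (fun n : nat => if n == 0%N then B else \bigcup_n A n)) => -[|n].
have UE : \bigcup_n (if n == 0%N then B else \bigcup_n A n) = (B `\` \bigcup_n A n) `|` \bigcup_n A n.
  apply/seteqP; split => x.
    move=> [[|n] _ /= h]; last by right.
    by have [|] := pselect ((\bigcup_n A n) x); [right|left].
  by move=> [[h _]|h]; [exists 0%N|exists 1%N].
have leS : (mu (B `\` \bigcup_n A n) + mu (\bigcup_n A n) <= ereal_sup S)%E.
  rewrite -measureU//; last 2 first.
  - exact: measurableD.
  - by apply/seteqP; split => x //= [[]].
  by rewrite -UE; apply: ereal_sup_ubound; eexists; last reflexivity.
have geS : (ereal_sup S <= mu (\bigcup_n A n))%E.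
  apply/lee_addgt0Pr => e e0.
  have [n ne] : exists n, n.+1%:R^-1 < e.
    by have [n h] := ltr_add_invr (ltac:(by [] ) : 0 < e); exists n; rewrite add0r in h.
  case: (HA n) => CAn hn.
  apply: ltW; rewrite -lteBlDr//; apply: le_lt_trans (lt_le_trans hn _); last first.
    by apply: le_measure; rewrite ?inE//; [exact: mC|exact: bigcup_sup].
  by rewrite leeB// lee_fin ltW.
apply/eqP; rewrite eq_le measure_ge0 andbT.
rewrite -(@leeD2rE _ (mu (\bigcup_n A n))) ?add0e ?fin_num_measure//.
exact: le_trans leS geS.
Qed.

(** Exhaustion applied to the measurable sets disjoint from [S]. *)
Lemma hull (S : set X) : exists H, [/\ measurable H, S `<=` H &
  forall G, measurable G -> S `<=` G -> mu (H `\` G) = 0%E].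
Proof.
have [||A hA|W [mW WS] hW] :=
    @exhaustion [set C | measurable C /\ S `<=` ~` C].
- by split => //; rewrite setC0.
- by move=> A [].
- split; first by apply: bigcup_measurable => n _; case: (hA n).
  by move=> x Sx [n _ Anx]; case: (hA n) => _ /(_ x Sx); exact.
exists (~` W); split; [exact: measurableC|by []|move=> G mG SG].
have -> : ~` W `\` G = ~` G `\` W by rewrite !setDE setIC.
by apply: hW; split; [exact: measurableC|rewrite setCK].
Qed.

End null_sets.

(** * Souslin schemes and their measurability *)
Lemma branch_of_prefixes (F : nat -> seq nat) :
  (forall k, exists2 w, F k.+1 = F k ++ w & w != [::]) ->
  exists b : nat -> nat, forall k, mkseq b (size (F k)) = F k.
Proof.
move=> hF.
have pre k m : exists w, F (m + k)%N = F k ++ w.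
  elim: m => [|m [w hw]]; first by exists [::]; rewrite cats0.
  by have [w' h' _] := hF (m + k)%N; exists (w ++ w'); rewrite addSn h' hw catA.
have sz k : (k <= size (F k))%N.
  elim: k => // k IH; have [w -> w0] := hF k.
  rewrite size_cat -addn1 leq_add//; by case: w w0.
exists (fun n => nth 0%N (F n.+1) n) => k.
apply: (@eq_from_nth _ 0%N); rewrite size_mkseq// => i ik; rewrite nth_mkseq//.
have [ki|ki] := leqP k i.+1.
  have [w] := pre k (i.+1 - k)%N; rewrite subnK// => ->.
  by rewrite nth_cat ik.
have [w] := pre i.+1 (k - i.+1)%N; rewrite subnK; last exact: ltnW.
by move=> ->; rewrite nth_cat (leq_trans _ (sz _)).
Qed.

Lemma branch_of_steps (G : seq nat -> Prop) t : G t ->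
  (forall s, G s -> exists i, G (rcons s i)) ->
  exists b : nat -> nat, mkseq b (size t) = t /\
    forall n, (size t <= n)%N -> G (mkseq b n).
Proof.
move=> Gt step.
have [c hc] : {c : seq nat -> nat & forall s, G s -> G (rcons s (c s))}.
  apply: (@choice _ _ (fun s i => G s -> G (rcons s i))) => s.
  by have [/step[i]|] := pselect (G s); [exists i|exists 0%N].
pose F := fix F k := if k is k'.+1 then rcons (F k') (c (F k')) else t.
have GF k : G (F k) by elim: k => //= k; exact: hc.
have [|b hb] := @branch_of_prefixes F.
  by move=> k; exists [:: c (F k)] => //=; rewrite cats1.
have szF k : size (F k) = (size t + k)%N.
  by elim: k => [|k IH]; rewrite ?addn0//= size_rcons IH addnS.
exists b; split; first exact: (hb 0%N).
by move=> n tn; rewrite -(subnKC tn) -szF hb.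
Qed.

Section souslin.
Context (R : realType) (d : measure_display) (X : measurableType d).
Variable mu : probability X R.

Lemma measurable_bigcup_count (I : countType) (F : I -> set X) :
  (forall i, measurable (F i)) -> measurable (\bigcup_i F i).
Proof. by move=> mF; apply: countable_bigcupT_measurable => //; exact: countableP. Qed.

Lemma negligible_bigcup_count (I : countType) (F : I -> set X) :
  (forall i, mu.-negligible (F i)) -> mu.-negligible (\bigcup_i F i).
Proof.
move=> nF; pose G n := if unpickle n is Some i then F i else set0.
apply: (@negligibleS _ _ _ _ (\bigcup_n G n)).
  by move=> x [i _ Fx]; exists (pickle i) => //; rewrite /G pickleK.
by apply: negligible_bigcup => n; rewrite /G; case: unpickle => // ; exact: negligible_set0.
Qed.

Lemma take_mkseq (b : nat -> nat) m n : (m <= n)%N -> take m (mkseq b n) = mkseq b m.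
Proof. by move=> mn; rewrite /mkseq -map_take take_iota (minn_idPl mn). Qed.

Definition souslin_at (Q : seq nat -> set X) t :=
  [set x | exists b : nat -> nat, mkseq b (size t) = t /\ forall n, Q (mkseq b n) x].

Lemma souslin_at_step Q t : souslin_at Q t `<=` \bigcup_i souslin_at Q (rcons t i).
Proof.
move=> x [b [bt Qb]]; exists (b (size t)) => //; exists b; split=> //.
by rewrite size_rcons mkseqS bt.
Qed.

(** Let [K t] be a measurable hull, inside the scheme, of the set of points with
    a branch through [t]. The set of points of [K t] that lie in no [K (rcons t i)]
    is null, because the [K (rcons t i)] together already cover the points with a
    branch through [t]. A point outside these countably many null sets can be
    followed down the tree from any [K t] that contains it, and hence has a
    branch. *)
Lemma souslin_measurable (Q : seq nat -> set X) : (forall t, measurable (Q t)) ->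
  exists N, [/\ measurable N, mu N = 0%E &
    forall t, measurable (souslin_at Q t `\` N)].
Proof.
move=> mQ.
pose QQ t := \bigcap_(j in [set j | (j <= size t)%N]) Q (take j t).
have mQQ t : measurable (QQ t) by apply: bigcap_measurableType.
have [H HH] := choice (fun t => hull mu (souslin_at Q t)).
pose K t := H t `&` QQ t.
have mK t : measurable (K t) by apply: measurableI => //; case: (HH t).
have SK t : souslin_at Q t `<=` K t.
  move=> x Sx; split; first by case: (HH t) => _ + _; exact.
  by case: Sx => b [bt Qb] j /= jt; rewrite -bt take_mkseq.
pose D t := K t `\` \bigcup_i K (rcons t i).
have mU t : measurable (\bigcup_i K (rcons t i)) by exact: bigcupT_measurable.
have mD t : measurable (D t) by exact: measurableD.
have nD : mu.-negligible (\bigcup_t D t).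
  apply: negligible_bigcup_count => t; exists (H t `\` \bigcup_i K (rcons t i)); split.
  - by apply: measurableD => //; case: (HH t).
  - case: (HH t) => _ _; apply => //.
    by move=> x /souslin_at_step[i _ Si]; exists i => //; exact: SK.
  - by move=> x [[]].
have mN : measurable (\bigcup_t D t) by exact: measurable_bigcup_count.
exists (\bigcup_t D t); split => //; first exact/negligibleP.
move=> t; suff -> : souslin_at Q t `\` \bigcup_t D t = K t `\` \bigcup_t D t by exact: measurableD.
apply/seteqP; split=> x [h nx]; split => //; first exact: SK.
have [|b [bt hb]] := @branch_of_steps (fun s => K s x) t h.
  move=> s Ks; apply: contrapT => /forallNP nK; apply: nx; exists s => //; split => //.
  by case=> i _; exact: nK.
exists b; split => // n; have := hb (maxn n (size t)) (leq_maxr _ _).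
by case=> _ /(_ n); rewrite /= size_mkseq take_mkseq ?leq_maxl//; apply.
Qed.

End souslin.

(** * Covering countable sections by measurable graphs *)
Section countable_sections.
Context (R : realType) (d : measure_display) (X : measurableType d) (P : topologicalType).
Variable mu : probability X R.
Variables (A : seq nat -> set X) (B : seq nat -> set P) (p0 : P).
Hypothesis mA : forall t, measurable (A t).
Hypothesis Bnest : forall b m n, (m <= n)%N -> B (mkseq b n) `<=` B (mkseq b m).
Hypothesis Blim : forall b, (forall n, B (mkseq b n) !=set0) ->
  exists p, forall n, B (mkseq b n) p.
Hypothesis Bshrink : forall b p U, open U -> U p -> (forall n, B (mkseq b n) p) ->
  exists n, B (mkseq b n) `<=` U.
Hypothesis hausP : forall p q : P, p <> q ->
  exists U V, [/\ open U, open V, U p, V q & U `&` V = set0].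

Definition covered (G : X -> P -> Prop) := exists (phi : nat -> X -> P) (N : set X),
  [/\ mu.-negligible N, forall i U, open U -> measurable (phi i @^-1` U) &
   forall x p, ~ N x -> G x p -> exists i, phi i x = p].

Lemma covered_sub (G H : X -> P -> Prop) : (forall x p, G x p -> H x p) ->
  covered H -> covered G.
Proof.
by move=> GH [phi [N [nN mphi hphi]]]; exists phi, N; split => // x p nx /GH; exact: hphi.
Qed.

Lemma covered_null (G : X -> P -> Prop) (N : set X) : mu.-negligible N ->
  (forall x p, G x p -> N x) -> covered G.
Proof.
move=> nN GN; exists (fun _ _ => p0), N; split => //.
  by move=> i U oU; rewrite preimage_cst; case: ifP.
by move=> x p nx /GN.
Qed.

Lemma covered_bigcup (I : countType) (G : I -> X -> P -> Prop) :
  (forall i, covered (G i)) -> covered (fun x p => exists i, G i x p).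
Proof.
move=> cG.
have [phi hphi] := choice cG; have [N hN] := choice hphi.
exists (fun m => if unpickle m is Some (i, n) then phi i n else fun=> p0), (\bigcup_i N i).
split.
- by apply: negligible_bigcup_count => i; case: (hN i).
- move=> m U oU; case: unpickle => [[i n]|]; first by case: (hN i) => _ + _; exact.
  by rewrite preimage_cst; case: ifP.
- move=> x p nx [i Gi]; case: (hN i) => _ _ /(_ x p) [||n <-] //.
    by move=> Nx; apply: nx; exists i.
  by exists (pickle (i, n)); rewrite pickleK.
Qed.

Definition branch (A : seq nat -> set X) t (x : X) (p : P) :=
  exists b : nat -> nat, mkseq b (size t) = t /\
    forall n, A (mkseq b n) x /\ B (mkseq b n) p.

Lemma branch_prefix A' t s x p : branch A' (t ++ s) x p -> branch A' t x p.
Proof.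
case=> b [bt h]; exists b; split => //.
by rewrite -(@take_mkseq b _ (size (t ++ s))) ?size_cat ?leq_addr// -size_cat bt take_size_cat.
Qed.

(** Remove from each node [t] a maximal set [W t] of points over which the part
    of the set below [t] can be covered by countably many measurable graphs. What
    remains at [t] over a point is almost never a single element, since the points
    with a single element form a measurable set [K t] over which that element is a
    measurable function, so that [K t] lies in [W t] up to a null set. If over such
    a point anything were left, one could descend in the tree and avoid the
    elements [e 0], [e 1], ... of the countable section one after the other; the
    limit of the branch would be an element of the section that is not listed. *)
Lemma countable_sections_covered :
  (forall x, countable [set p | branch A [::] x p]) -> covered (branch A [::]).
Proof.
move=> cE.
have exW t : exists W, (measurable W /\ covered (fun x p => W x /\ branch A t x p)) /\
    forall C, measurable C -> covered (fun x p => C x /\ branch A t x p) -> mu (C `\` W) = 0%E.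
  have [| |F hF|W hW maxW] := @exhaustion _ _ _ mu
    [set C | measurable C /\ covered (fun x p => C x /\ branch A t x p)].
  - by split => //; apply: (@covered_null _ set0); [exact: negligible_set0|move=> x p []].
  - by move=> C [].
  - split; first by apply: bigcupT_measurable => n; case: (hF n).
    apply: covered_sub (@covered_bigcup _ (fun n x p => F n x /\ branch A t x p) _).
      by move=> x p [[n _ Fx] br]; exists n.
    by move=> n; case: (hF n).
  - by exists W; split => // C mC cC; exact: maxW.
have [W hW] := choice exW.
have mW t : measurable (W t) by case: (hW t) => -[].
have cW t : covered (fun x p => W t x /\ branch A t x p) by case: (hW t) => -[].
pose A' t := A t `\` W t.
have mA' t : measurable (A' t) by exact: measurableD.
(* A branch either survives the removal or passes through a removed node. *)
have split_br t x p : branch A t x p -> branch A' t x p \/ exists s, W s x /\ branch A s x p.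
  case=> b [bt h]; have [[n Wn]|nW] := pselect (exists n, W (mkseq b n) x).
    by right; exists (mkseq b n); split => //; exists b; rewrite size_mkseq.
  left; exists b; split => // n; split; last by case: (h n).
  by split; [case: (h n)|move=> Wn; apply: nW; exists n].
pose Q t := [set x | A' t x /\ B t !=set0].
have mQ t : measurable (Q t).
  have [B0|B0] := pselect (B t !=set0).
    by rewrite (_ : Q t = A' t) //; apply/seteqP; split=> x // -[].
  by rewrite (_ : Q t = set0) //; apply/seteqP; split=> x // -[].
have [N1 [mN1 N10 mS]] := souslin_measurable mu mQ.
pose PP t := souslin_at Q t.
have PPE t x : PP t x <-> exists p, branch A' t x p.
  split=> [[b [bt hb]]|[p [b [bt hb]]]].
    have [|p hp] := Blim (b := b); first by move=> n; case: (hb n).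
    by exists p, b; split => // n; split => //; case: (hb n).
  by exists b; split => // n; case: (hb n) => ? ?; split => //; exists p.
pose sep t (s : seq nat * seq nat) := B (t ++ s.1) `&` B (t ++ s.2) = set0.
pose K t := PP t `\` N1 `\` \bigcup_(s : seq nat * seq nat)
   (if `[< sep t s >] then (PP (t ++ s.1) `\` N1) `&` (PP (t ++ s.2) `\` N1) else set0).
have mK t : measurable (K t).
  apply: measurableD => //; apply: measurable_bigcup_count => s.
  by case: ifP => // _; exact: measurableI.
have ext t x p b U : open U -> U p -> mkseq b (size t) = t ->
    (forall n, A' (mkseq b n) x /\ B (mkseq b n) p) ->
    exists s, B (t ++ s) `<=` U /\ branch A' (t ++ s) x p.
  move=> oU Up bt hb; have [|n BU] := Bshrink oU Up (b := b); first by move=> n; case: (hb n).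
  exists (drop (size t) (mkseq b (maxn n (size t)))).
  have -> : t ++ drop (size t) (mkseq b (maxn n (size t))) = mkseq b (maxn n (size t)).
    by rewrite -{1}bt -(@take_mkseq b _ (maxn n (size t))) ?leq_maxr// cat_take_drop.
  split; first by move=> q /(Bnest (leq_maxl _ _)) /BU.
  by exists b; rewrite size_mkseq.
(* Two different elements below [t] are separated by two disjoint sets of the
   scheme, so uniqueness fails on a countable union of measurable sets. *)
have Kuniq t x : ~ N1 x -> PP t x ->
    (K t x <-> forall p q, branch A' t x p -> branch A' t x q -> p = q).
  move=> nN Px; split=> [[_ h] p q [b [bt hb]] [c [ct hc]]|h].
    apply: contrapT => /hausP[U [V [oU oV Up Vq UV]]].
    have [s [sU bs]] := ext _ _ _ _ _ oU Up bt hb.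
    have [s' [sV bs']] := ext _ _ _ _ _ oV Vq ct hc.
    apply: h; exists (s, s') => //=; case: asboolP => [_|[]].
      by split; split => //; apply/PPE; [exists p|exists q].
    by rewrite /sep /= -subset0 -UV; exact: setISS.
  split => // -[[s s'] _] /=; case: asboolP => // hs [[/PPE[p hp] _] [/PPE[q hq] _]].
  have pq := h _ _ (branch_prefix hp) (branch_prefix hq).
  have : (B (t ++ s) `&` B (t ++ s')) p.
    split; first by case: hp => b [bt hb]; rewrite -bt; case: (hb (size (t ++ s))).
    by rewrite pq; case: hq => b [bt hb]; rewrite -bt; case: (hb (size (t ++ s'))).
  by rewrite [X in X p]hs.
have Knull t : mu (K t) = 0%E.
  have KW : K t `\` W t = K t.
    apply/seteqP; split=> x; first by case.
    move=> Kx; split => // Wx.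
    case: Kx => -[[b [bt hb]] _] _.
    by have [[_]] := hb (size t); rewrite bt.
  rewrite -KW; case: (hW t) => _; apply => //.
  apply: covered_sub (@covered_bigcup bool (fun (i : bool) x p => if i then K t x /\ branch A' t x p
      else exists s, W s x /\ branch A s x p) _).
    by move=> x p [Kx /split_br[h|h]]; [exists true|exists false].
  case; last by apply: (@covered_bigcup _ (fun s x p => W s x /\ branch A s x p)).
  have [f hf] : {f : X -> P & forall x, if `[< K t x >] then branch A' t x (f x) else f x = p0}.
    apply: (@choice _ _ (fun x p => if `[< K t x >] then branch A' t x p else p = p0)) => x.
    case: asboolP => [[[/PPE]]//|_]; by exists p0.
  exists (fun=> f), set0; split; first exact: negligible_set0.
    move=> _ U oU.
    rewrite (_ : f @^-1` U = (K t `&` \bigcup_s (if `[< B (t ++ s) `<=` U >] then PP (t ++ s) `\` N1 else set0))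
        `|` (if `[< U p0 >] then ~` K t else set0)).
      apply: measurableU; last by case: ifP => // _; exact: measurableC.
      apply: measurableI => //; apply: measurable_bigcup_count => s.
      by case: ifP.
    apply/seteqP; split=> x /=.
      move=> Ufx; have := hf x; case: asboolP => [Kx [b [bt hb]]|nK fx].
        left; split => //; have [s [sU bs]] := ext _ _ _ _ _ oU Ufx bt hb.
        exists s => //; case: asboolP => // _; split; first by apply/PPE; exists (f x).
        by case: Kx => -[].
      by right; rewrite -fx; case: asboolP.
    case=> [[Kx [s _]]|].
      case: asboolP => // BU [/PPE[p hp] nN].
      have := hf x; case: asboolP => // _ hfx.
      have PPx : PP t x by case: Kx => -[].
      have -> := (Kuniq _ _ nN PPx).1 Kx _ _ hfx (branch_prefix hp).
      by apply: BU; case: hp => b [bt hb]; rewrite -bt; case: (hb (size (t ++ s))).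
    case: asboolP => // Up nK; have := hf x; case: asboolP => // _ ->//.
  move=> x p _ [Kx br]; exists 0%N; have := hf x; case: asboolP => // _ hfx.
  by case: (Kx) => -[Px nN] _; exact: (Kuniq _ _ nN Px).1 Kx _ _ hfx br.
have N2 : mu.-negligible (N1 `|` \bigcup_t K t).
  apply: negligibleU; first exact/negligibleP.
  by apply: negligible_bigcup_count => t; apply/negligibleP; [exact: mK|exact: Knull].
(* The descent that leaves every enumerated element behind. *)
have noP x : ~ (N1 `|` \bigcup_t K t) x -> ~ PP [::] x.
  move=> nx P0.
  have nN1 : ~ N1 x by move=> h; apply: nx; left.
  have nK t : ~ K t x by move=> h; apply: nx; right; exists t.
  have [e he] : exists e : nat -> P, forall p, branch A [::] x p -> exists k, e k = p.
    have /pfcard_geP[E0|[g]] := cE x.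
      exists (fun=> p0) => p hp; suff : set0 p by [].
      by rewrite -E0.
    exists g => p hp; have [k _ <-] := 'surj_g (hp : [set p | branch A [::] x p] p).
    by exists k.
  have step k s : exists w, PP s x -> w != [::] /\ PP (s ++ w) x /\ ~ B (s ++ w) (e k).
    have [Ps|] := pselect (PP s x); last by exists [::].
    have : exists p, branch A' s x p /\ p <> e k.
      apply: contrapT => /forallNP h; apply: (nK s); apply/Kuniq => // p q hp hq.
      have -> : p = e k by apply: contrapT => ne; apply: (h p).
      by symmetry; apply: contrapT => ne; apply: (h q).
    case=> p [[b [bt hb]] pe].
    have [U [V [oU oV Up Vq UV]]] := hausP pe.
    have [w [BU bw]] := ext _ _ _ _ _ oU Up bt hb.
    case: bw => c [ct hc].
    exists (rcons w (c (size (s ++ w)))) => _; split; first by case: (w).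
    have E : s ++ rcons w (c (size (s ++ w))) = mkseq c (size (s ++ w)).+1.
      by rewrite mkseqS ct rcons_cat.
    rewrite E; split; first by apply/PPE; exists p, c; rewrite size_mkseq.
    move=> /(Bnest (leqnSn _)); rewrite ct => /BU Ue.
    suff : set0 (e k) by []. by rewrite -UV.
  have [w hw] : {w : nat * seq nat -> seq nat & forall ks, PP ks.2 x -> w ks != [::] /\
       PP (ks.2 ++ w ks) x /\ ~ B (ks.2 ++ w ks) (e ks.1)}.
    by apply: (@choice _ _ (fun (ks : nat * seq nat) w => PP ks.2 x -> w != [::] /\
       PP (ks.2 ++ w) x /\ ~ B (ks.2 ++ w) (e ks.1))) => -[k s]; exact: step.
  pose F := fix F k := if k is k'.+1 then F k' ++ w (k', F k') else [::].
  have PF k : PP (F k) x by elim: k => //= k /(hw (k, F k))[_ []].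
  have wF k : w (k, F k) != [::] by have [] := hw (k, F k) (PF k).
  have [|b hb] := @branch_of_prefixes F; first by move=> k; exists (w (k, F k)).
  have szF k : (k <= size (F k))%N.
    elim: k => // k IH; rewrite /= size_cat -addn1 leq_add// lt0n size_eq0.
    exact: wF.
  have QF n : Q (mkseq b n) x.
    have [c [ct hc]] := PF n; have := hc n.
    by rewrite -(@take_mkseq c _ (size (F n))) ?szF// ct -hb take_mkseq// szF.
  have [|p hp] := Blim (b := b); first by move=> n; case: (QF n).
  have [|k ek] := he p.
    by exists b; split => // n; split => //; case: (QF n) => -[].
  have [_ [_ ]] := hw (k, F k) (PF k); apply.
  by rewrite ek; have := hp (size (F k.+1)); rewrite hb.
apply: covered_sub (@covered_bigcup bool (fun (i : bool) x p => if i then (N1 `|` \bigcup_t K t) x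
      else exists s, W s x /\ branch A s x p) _).
  move=> x p br; have [Nx|nN] := pselect ((N1 `|` \bigcup_t K t) x); first by exists true.
  exists false; case: (split_br _ _ _ br) => // h.
  by case: (noP _ nN); apply/PPE; exists p.
case; first exact: covered_null N2 _.
by apply: (@covered_bigcup _ (fun s x p => W s x /\ branch A s x p)).
Qed.

End countable_sections.

(** * Borel sets as Souslin schemes of closed rectangles *)
Section schemes.
Context (d : measure_display) (X : measurableType d) (P : topologicalType).
Implicit Type Z : X -> P -> Prop.

(** Souslin operation over products of a measurable set and a closed set. *)
Definition analytic Z := exists (A : seq nat -> set X) (B : seq nat -> set P),
  [/\ forall t, measurable (A t), forall t, closed (B t) &
      forall x p, Z x p <-> exists b, forall n, A (mkseq b n) x /\ B (mkseq b n) p].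

Lemma analytic_rect (A : set X) (B : set P) : measurable A -> closed B ->
  analytic (fun x p => A x /\ B p).
Proof.
move=> mA cB; exists (fun=> A), (fun=> B); split => // x p; split=> [h|[b /(_ 0%N)]//].
by exists id.
Qed.

Lemma analytic_bigcup (Z : nat -> X -> P -> Prop) : (forall i, analytic (Z i)) ->
  analytic (fun x p => exists i, Z i x p).
Proof.
move=> aZ; have [A hA] := choice aZ; have [B hB] := choice hA.
exists (fun t => if t is i :: s then A i s else setT), (fun t => if t is i :: s then B i s else setT).
split.
- by case=> [|i s]//; case: (hB i).
- by case=> [|i s]; [exact: closedT|case: (hB i)].
- have E (b : nat -> nat) n : mkseq b n.+1 = b 0%N :: mkseq (b \o S) n.
    by rewrite /mkseq /= -[1%N]addn0 iotaDl -map_comp.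
  move=> x p; split.
  + case=> i; case: (hB i) => _ _ -> [b hb].
    exists (fun n => if n is m.+1 then b m else i) => -[|n] //; rewrite E; exact: hb.
  + case=> b hb; exists (b 0%N); case: (hB (b 0%N)) => _ _ ->; exists (b \o S) => n.
    by have := hb n.+1; rewrite E.
Qed.

(** A branch for the intersection codes countably many branches at once, the
    [k]-th one being read off at the positions [pickle (k, i)]. A node of length
    [m] can only see the initial segments that fit below [m], which is the
    condition [ok]. *)
Lemma analytic_bigcap (Z : nat -> X -> P -> Prop) : (forall i, analytic (Z i)) ->
  analytic (fun x p => forall i, Z i x p).
Proof.
move=> aZ; have [A hA] := choice aZ; have [B hB] := choice hA.
pose ok (t : seq nat) (k n : nat) := forall i, (i < n)%N -> (pickle (k, i) < size t)%N.
pose sub (t : seq nat) (k n : nat) := mkseq (fun i => nth 0%N t (pickle (k, i))) n.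
exists (fun t => \bigcap_k \bigcap_(n in ok t k) A k (sub t k n)),
       (fun t => \bigcap_k \bigcap_(n in ok t k) B k (sub t k n)); split.
- move=> t; apply: bigcap_measurableType => k _; apply: bigcap_measurableType => n _.
  by case: (hB k).
- move=> t; apply: closed_bigI => k _; apply: closed_bigI => n _.
  by case: (hB k).
- have subE b m k n : ok (mkseq b m) k n -> sub (mkseq b m) k n = mkseq (fun i => b (pickle (k, i))) n.
    move=> h; apply/eq_in_map => i; rewrite mem_iota /= add0n => /h.
    by rewrite size_mkseq => /(nth_mkseq 0%N b).
  move=> x p; split=> [h|[b hb] k].
    have [b hb] : {b : nat -> nat -> nat & forall k n,
        A k (mkseq (b k) n) x /\ B k (mkseq (b k) n) p}.
      apply: (@choice _ _ (fun k b => forall n, A k (mkseq b n) x /\ B k (mkseq b n) p)) => k.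
      by case: (hB k) => _ _ <-.
    exists (fun m => if unpickle m is Some (k, i) then b k i else 0%N) => m.
    split=> k _ n okn; rewrite subE//.
      have -> : (fun i => if unpickle (pickle (k, i)) is Some (k, i) then b k i else 0%N) = b k.
        by apply/funext => i; rewrite pickleK.
      by case: (hb k n).
    have -> : (fun i => if unpickle (pickle (k, i)) is Some (k, i) then b k i else 0%N) = b k.
      by apply/funext => i; rewrite pickleK.
    by case: (hb k n).
  case: (hB k) => _ _ ->; exists (fun i => b (pickle (k, i))) => n.
  pose m := (\max_(i < n) (pickle (k, nat_of_ord i)).+1)%N.
  have okn : ok (mkseq b m) k n.
    by move=> i ni; rewrite size_mkseq; exact: (@leq_bigmax _ (fun i : 'I_n => (pickle (k, nat_of_ord i)).+1) (Ordinal ni)).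
  by have [/(_ k I n okn) + /(_ k I n okn)] := hb m; rewrite !subE.
Qed.

Lemma analytic_ext Z Z' : (forall x p, Z x p <-> Z' x p) -> analytic Z -> analytic Z'.
Proof.
move=> ZZ' [A [B [mA cB h]]]; exists A, B; split => // x p.
by rewrite -ZZ'.
Qed.

Lemma analytic_and Z Z' : analytic Z -> analytic Z' -> analytic (fun x p => Z x p /\ Z' x p).
Proof.
move=> h h'; apply: analytic_ext (@analytic_bigcap (fun i => if i is 0 then Z else Z') _).
  by move=> x p; split => [H|[? ?] []//]; split; [exact: (H 0%N)|exact: (H 1%N)].
by case.
Qed.

Lemma analytic_or Z Z' : analytic Z -> analytic Z' -> analytic (fun x p => Z x p \/ Z' x p).
Proof.
move=> h h'; apply: analytic_ext (@analytic_bigcup (fun i => if i is 0 then Z else Z') _).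
  by move=> x p; split => [[[|i]]|[]]; [left|right|exists 0%N|exists 1%N].
by case.
Qed.

Definition bianalytic Z := analytic Z /\ analytic (fun x p => ~ Z x p).

Lemma bianalytic_bigcup (Z : nat -> X -> P -> Prop) : (forall i, bianalytic (Z i)) ->
  bianalytic (fun x p => exists i, Z i x p).
Proof.
move=> h; split; first by apply: analytic_bigcup => i; case: (h i).
apply: analytic_ext (@analytic_bigcap (fun i x p => ~ Z i x p) _).
  by move=> x p; rewrite forallNP.
by move=> i; case: (h i).
Qed.

Lemma bianalytic_not Z : bianalytic Z -> bianalytic (fun x p => ~ Z x p).
Proof. by case=> h h'; split => //; apply: analytic_ext h => x p; rewrite notK. Qed.

(** The sets which, together with their complement, are given by a scheme form a
    sigma-algebra. *)
Lemma bianalytic_sigma (T : Type) (G : set (set T)) (pr : X -> P -> T) :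
  (forall C, G C -> bianalytic (fun x p => C (pr x p))) ->
  forall C, <<s G >> C -> bianalytic (fun x p => C (pr x p)).
Proof.
move=> hG; apply: smallest_sub; last exact: hG.
split.
- have e := analytic_rect (A := setT) (B := set0) measurableT closed0.
  have f := analytic_rect (A := setT) (B := setT) measurableT closedT.
  by split; [apply: analytic_ext e => x p; split=> [[]|]|apply: analytic_ext f => x p; split=> // _ []].
- move=> C /bianalytic_not[h h']; split.
    by apply: analytic_ext h => x p; split => [?|[]].
  by apply: analytic_ext h' => x p; split=> [nn [_]|nn ?] //; apply: nn.
- move=> F hF; have [h h'] := bianalytic_bigcup hF.
  split; first by apply: analytic_ext h => x p; split => [[i Fi]|[i _ Fi]]; exists i.
  apply: analytic_ext h' => x p; split => nF.
    by case=> i _ Fi; apply: nF; exists i.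
  by case=> i Fi; apply: nF; exists i.
Qed.

End schemes.

(** * Almost everywhere enumeration of countable Borel sections *)
Section polish_sections.
Context (R : realType) (d : measure_display) (X : measurableType d) (P : metricType R).
Variable mu : probability X R.

Lemma closure_ball_double (x p : P) (r : R) : 0 < r -> closure (ball x r) p -> ball x (r + r) p.
Proof.
move=> r0 /(_ (ball p r) (nbhsx_ballx p r r0))[q [xq pq]].
exact: ball_triangle xq (ball_sym pq).
Qed.

Lemma open_bigcup_closed (U : set P) : open U ->
  exists2 C : nat -> set P, forall n, closed (C n) & forall p, U p <-> exists n, C n p.
Proof.
move=> oU; exists (fun n => ~` \bigcup_(q in ~` U) (ball q n.+1%:R^-1)^°).
  move=> n; apply: open_closedC; apply: bigcup_open => q _; exact: open_interior.
move=> p; split=> [Up|[n]].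
  have [e /= e0 pe] : nbhs_ball p U by apply/nbhs_ballP; exact: open_nbhs_nbhs.
  have [n] := ltr_add_invr e0; rewrite add0r => ne.
  exists n; case=> q nUq /interior_subset h; apply: nUq; apply: pe.
  by apply: ball_sym; exact: le_ball (ltW ne) _ h.
apply: contra_notP => nU; exists p => //.
by apply: nbhsx_ballx.
Qed.

Lemma analytic_open_rect (U : set P) : open U -> bianalytic (fun (x : X) p => U p).
Proof.
move=> oU; split.
  have [C cC UE] := open_bigcup_closed oU.
  apply: analytic_ext (@analytic_bigcup _ _ _ (fun n (x : X) p => setT x /\ C n p) _).
    by move=> x p; rewrite UE; split => [[n [_ h]]|[n h]]; exists n.
  by move=> n; exact: analytic_rect.
apply: analytic_ext (@analytic_rect _ X P setT (~` U) measurableT (open_closedC oU)).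
by move=> x p; split => [[]|].
Qed.

(** The scheme is refined so that a branch also names, at its [i]-th step, a
    point of the dense sequence within [1 / (i + 1)]. Completeness then makes
    every branch of nonempty closed sets converge. *)
Lemma polish_covered (Z : X -> P -> Prop) : polish P -> analytic Z -> P ->
  (forall x, countable [set p | Z x p]) -> covered mu Z.
Proof.
move=> [[D cD dD] cP] [A [B [mA cB ZE]]] p0 cZ.
have [D0|[dl] hdl] : (D = set0) \/ exists dl : nat -> P, forall p, D p -> exists k, dl k = p.
    have /pfcard_geP[->|[g]] := cD; first by left.
    by right; exists g => p Dp; have [k _ <-] := 'surj_g Dp; exists k.
  by have [|p [_]] := dD setT _ openT; [exists p0|rewrite D0].
pose dec (i : nat) : option (nat * nat) := unpickle i.
pose d1 (i : nat) : nat := if dec i is Some (a, b) then a else 0%N.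
pose d2 (i : nat) : nat := if dec i is Some (a, b) then b else 0%N.
pose A' t := \bigcap_(j in [set j | (j <= size t)%N]) A (take j (map d1 t)).
pose B' t := \bigcap_(j in [set j | (j <= size t)%N]) B (take j (map d1 t)) `&`
  \bigcap_(i in [set i | (i < size t)%N]) closure (ball (dl (d2 (nth 0%N t i))) i.+1%:R^-1).
have mA' t : measurable (A' t) by exact: bigcap_measurableType.
have cB' t : closed (B' t).
  apply: closedI; apply: closed_bigI => i _ //; exact: closed_closure.
have d1E b n j : (j <= n)%N -> take j (map d1 (mkseq b n)) = mkseq (d1 \o b) j.
  by move=> jn; rewrite -map_take take_mkseq// /mkseq -map_comp.
have A'E b n x : A' (mkseq b n) x <-> forall j, (j <= n)%N -> A (mkseq (d1 \o b) j) x.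
  by split=> h j jn; [rewrite -(d1E _ n)//; apply: h; rewrite /= size_mkseq|
     rewrite /= size_mkseq in jn; rewrite d1E//; exact: h].
have B'E b n p : B' (mkseq b n) p <-> (forall j, (j <= n)%N -> B (mkseq (d1 \o b) j) p) /\
   forall i, (i < n)%N -> closure (ball (dl (d2 (b i))) i.+1%:R^-1) p.
  split=> -[h h'].
    split=> i; first by move=> jn; rewrite -(d1E _ n)//; apply: h; rewrite /= size_mkseq.
    by move=> jn; rewrite -(nth_mkseq 0%N b jn); apply: h'; rewrite /= size_mkseq.
  split=> i /=; rewrite size_mkseq => jn; first by rewrite d1E//; exact: h.
  by rewrite nth_mkseq//; exact: h'.
have nest b m n : (m <= n)%N -> B' (mkseq b n) `<=` B' (mkseq b m).
  move=> mn p /B'E[h h']; apply/B'E; split=> i im.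
    by apply: h; exact: leq_trans mn.
  by apply: h'; exact: leq_trans mn.
have inv2 (e : R) : 0 < e -> exists n : nat, n.+1%:R^-1 + n.+1%:R^-1 < e.
  move=> e0; have e2 : 0 < e / 2 by rewrite divr_gt0.
  have [n] := ltr_add_invr e2; rewrite add0r => h; exists n.
  by rewrite [ltRHS](splitr e) ltrD.
have lim b : (forall n, B' (mkseq b n) !=set0) -> exists p, forall n, B' (mkseq b n) p.
  move=> /choice[q hq].
  have [|p qp] := cP (q @ \oo) _.
    apply: cauchy_exP => e /inv2[n ne].
    exists (dl (d2 (b n))); exists n.+1 => // m /= nm.
    have /B'E[_ /(_ n nm)] := hq m.
    by move=> /closure_ball_double h; apply: le_ball (ltW ne) _ (h _).
  exists p => n; apply: (@closed_cvg _ _ \oo _ q (B' (mkseq b n))) => //.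
  by exists n => // m /= nm; apply: nest (hq m).
have shrink b p U : open U -> U p -> (forall n, B' (mkseq b n) p) ->
    exists n, B' (mkseq b n) `<=` U.
  move=> oU Up hp.
  have [e /= e0 pe] : nbhs_ball p U by apply/nbhs_ballP; exact: open_nbhs_nbhs.
  have e2 : 0 < e / 2 by rewrite divr_gt0.
  have [n ne] := inv2 _ e2; exists n.+1 => q hq.
  have /B'E[_ /(_ _ (ltnSn n)) qn] := hq.
  have /B'E[_ /(_ _ (ltnSn n)) pn] := hp n.+1.
  apply: pe; apply: (@ball_splitr _ _ (dl (d2 (b n))));
    apply: le_ball (ltW ne) _ _; exact: closure_ball_double.
have hausP (p q : P) : p <> q -> exists U V, [/\ open U, open V, U p, V q & U `&` V = set0].
  move=> /eqP pq; have := @metric_hausdorff R P; rewrite open_hausdorff => /(_ p q pq).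
  case=> -[U V] /= [/set_mem Up /set_mem Vq] [oU oV /eqP UV].
  by exists U, V.
have brE x p : branch B' A' [::] x p <-> Z x p.
  rewrite ZE; split=> [[b [_ h]]|[b h]].
    exists (d1 \o b) => n; have [/A'E /(_ n (leqnn n)) ? /B'E[/(_ n (leqnn n)) ? _]] := h n.
    by split.
  have [c hc] : {c : nat -> nat & forall i, ball (dl (c i)) i.+1%:R^-1 p}.
    apply: (@choice _ _ (fun i k => ball (dl k) i.+1%:R^-1 p)) => i.
    have [|q [/interior_subset pq /hdl[k dk]]] := dD (ball p i.+1%:R^-1)^° _ (open_interior _).
      by exists p; exact: nbhsx_ballx.
    by exists k; rewrite dk; exact: ball_sym.
  have d1b : d1 \o (fun i => pickle (b i, c i)) = b by apply/funext => i; rewrite /d1 /dec /= pickleK.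
  exists (fun i => pickle (b i, c i)); split => // n; split.
    by apply/A'E => j jn; rewrite d1b; case: (h j).
  apply/B'E; split=> j jn; first by rewrite d1b; case: (h j).
  by apply: subset_closure; rewrite /d2 /dec pickleK; exact: hc.
apply: covered_sub (fun x p => (brE x p).2) _.
apply: countable_sections_covered => // x.
by rewrite (_ : [set p | _] = [set p | Z x p]) //; apply/seteqP; split => p /brE.
Qed.

End polish_sections.

(** Lusin-Novikov up to a null set. *)
Lemma standard_borel_enumeration (R : realType) (d : measure_display)
    (X : measurableType d) (mu : probability X R) (E : set (X * X)) :
  standard_borel R X -> measurable E -> (forall x, countable [set y | E (x, y)]) ->
  exists (phi : nat -> X -> X) (N : set X),
    [/\ mu.-negligible N, forall i, measurable_fun setT (phi i) &
        forall x y, ~ N x -> E (x, y) -> exists i, phi i x = y].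
Proof.
move=> [P [f [polP [g fK gK] mf]]] mE cE.
have mg (C : set P) : <<s [set U : set P | open U] >> C -> measurable (f @^-1` C).
  move=> mC; apply/mf; rewrite (_ : f @` _ = C) //.
  apply/seteqP; split=> [_ [x Cx <-]//|p Cp]; exists (g p); rewrite /= ?gK//.
have [X0|/existsNP[x0 _]] := pselect (forall x : X, False).
  exists (fun _ => id), set0; split; first exact: negligible_set0.
    by move=> _; exact: measurable_id.
  by move=> x; case: (X0 x).
have bE : bianalytic (fun (x : X) (p : P) => E (x, g p)).
  have := mE; rewrite measurable_prod_measurableType.
  apply: (@bianalytic_sigma _ X P _ _ (fun x p => (x, g p))) => _ [A mA [B mB <-]].
  have bA : bianalytic (fun (x : X) (p : P) => A x).
    split.
      apply: analytic_ext (@analytic_rect _ X P A setT mA closedT).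
      by move=> x p; split => [[]|].
    apply: analytic_ext (@analytic_rect _ X P (~` A) setT (measurableC mA) closedT).
    by move=> x p; split => [[]|].
  have bB : bianalytic (fun (x : X) (p : P) => B (g p)).
    have [h h'] : bianalytic (fun (x : X) (p : P) => (f @` B) p).
      apply: (@bianalytic_sigma _ X P _ _ (fun x p => p)) ((mf B).1 mB) => U oU.
      exact: analytic_open_rect.
    have EB p : (f @` B) p <-> B (g p).
      by split=> [[x Bx <-]|Bp]; [rewrite fK|exists (g p); rewrite // gK].
    by split; [apply: analytic_ext h|apply: analytic_ext h'] => x p; rewrite EB.
  case: bA bB => aA aA' [aB aB']; split; first exact: analytic_and.
  apply: analytic_ext (analytic_or aA' aB') => x p /=.
  by rewrite not_andE.
have [aE _] := bE.
have [|phi [N [nN mphi hphi]]] := polish_covered mu polP aE (f x0).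
  move=> x; have -> : [set p | E (x, g p)] = f @` [set y | E (x, y)].
    apply/seteqP; split=> [p Ep|_ [y Ey <-] /=]; first by exists (g p); rewrite // gK.
    by rewrite fK.
  exact: card_le_trans (card_image_le _ _) (cE x).
exists (fun i => g \o phi i), N; split => //.
- move=> i _ B mB; rewrite setTI.
  have -> : (g \o phi i) @^-1` B = phi i @^-1` (f @` B).
    apply/seteqP; split=> x /=; first by move=> Bx; exists (g (phi i x)) => //; rewrite gK.
    by case=> y By <-; rewrite fK.
  have := (mf B).1 mB; move: (f @` B) => C.
  suff : <<s [set U : set P | open U] >> `<=` [set C | measurable (phi i @^-1` C)] by apply.
  apply: smallest_sub => [|U oU]; last exact: mphi.
  split => [|F|F hF] /=.
  + by rewrite preimage_set0.
  + by rewrite setTD preimage_setC; exact: measurableC.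
  + by rewrite preimage_bigcup; exact: bigcupT_measurable.
- move=> x y nx Exy; have [|i hi] := hphi x (f y) nx; first by rewrite fK.
  by exists i; rewrite /= hi fK.
Qed.

(** * Sides of edges in acyclic graphs *)
Section reachability.
Context (X : choiceType) (T : set (X * X)).

Fixpoint reach (x y : X) (n : nat) : set X :=
  if n is m.+1 then [set v | exists u, [/\ reach x y m u, T (u, v) & v <> y]] else [set x].

(** The component of [x] in the graph with the vertex [y] removed; when [y] is a
    neighbour of [x] and the graph is acyclic, this is the half-space of the edge. *)
Definition side (x y : X) : set X := \bigcup_n reach x y n.

Lemma side_refl x y : side x y x. Proof. by exists 0%N. Qed.

Lemma side_step x y u v : side x y u -> T (u, v) -> v <> y -> side x y v.
Proof. by case=> n _ h Tuv vy; exists n.+1 => //; exists u. Qed.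

Lemma side_ind x y (Q : X -> Prop) : Q x ->
  (forall u v, side x y u -> Q u -> T (u, v) -> v <> y -> Q v) ->
  forall z, side x y z -> Q z.
Proof.
move=> Qx QS z [n _]; elim: n z => [z ->//|n IH z /= [u [hu Tuz zy]]].
by apply: (QS u) => //; [exists n|exact: IH].
Qed.

Lemma side_avoid x y z : x <> y -> side x y z -> z <> y.
Proof. by move=> xy; move: z; apply: side_ind => // u v _ _ _. Qed.

Lemma conn_refl x : conn_rel T (x, x). Proof. by exists [::]. Qed.

Lemma conn_step x u v : conn_rel T (x, u) -> T (u, v) -> conn_rel T (x, v).
Proof.
case=> s [/= ps ls] Tuv; exists (rcons s v); split; last by rewrite last_rcons.
by rewrite /= rcons_path ps ls /=; exact/mem_set.
Qed.

Lemma conn_ind x (Q : X -> Prop) : Q x ->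
  (forall u v, conn_rel T (x, u) -> Q u -> T (u, v) -> Q v) ->
  forall z, conn_rel T (x, z) -> Q z.
Proof.
move=> Qx QS z [s /= [ps <-{z}]].
elim/last_ind: s ps => [//|s v IH]; rewrite rcons_path last_rcons => /andP[ps /set_mem Tv].
by apply: (QS (last x s)) => //; [exists s|exact: IH].
Qed.

Lemma conn_trans x y z : conn_rel T (x, y) -> conn_rel T (y, z) -> conn_rel T (x, z).
Proof. by move=> xy; move: z; apply: conn_ind => // u v _; exact: conn_step. Qed.

Lemma side_conn x y : side x y `<=` eclass (conn_rel T) x.
Proof.
apply: side_ind; first exact: conn_refl.
by move=> u v _ h Tuv _; exact: conn_step Tuv.
Qed.

Lemma side_path x y z : x <> y -> side x y z ->
  exists s, [/\ path (adj T) x s, last x s = z & y \notin x :: s].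
Proof.
move=> xy; move: z; apply: side_ind.
  by exists [::]; split => //; rewrite inE; apply/eqP => yx; exact: xy.
move=> u v _ [s [ps ls ys]] Tuv vy; exists (rcons s v); split.
- by rewrite rcons_path ps ls; exact/mem_set.
- by rewrite last_rcons.
- by rewrite -rcons_cons mem_rcons inE negb_or ys andbT; apply/eqP => yv; exact: vy.
Qed.

Hypothesis gT : is_graph T.

Lemma graph_sym x y : T (x, y) -> T (y, x). Proof. exact: gT.2. Qed.

Lemma graph_neq x y : T (x, y) -> x <> y.
Proof. by move=> Txy xy; apply: (gT.1 x); rewrite {2}xy. Qed.

Lemma conn_sym x y : conn_rel T (x, y) -> conn_rel T (y, x).
Proof.
move: y; apply: conn_ind; first exact: conn_refl.
move=> u v _ h Tuv; apply: conn_trans h.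
by apply: conn_step (conn_refl v) _; exact: graph_sym.
Qed.

Lemma eclass_eq x y : conn_rel T (x, y) -> eclass (conn_rel T) x = eclass (conn_rel T) y.
Proof.
move=> xy; apply/seteqP; split=> z; apply: conn_trans => //; exact: conn_sym.
Qed.

(** A path from [x] that leaves the half-space does so through its only edge, and
    hence visits [y]. *)
Lemma half_space_side U x y : half_space T U -> T (x, y) -> U x -> ~ U y -> U = side x y.
Proof.
case=> cU [e [_ ue]] Txy Ux nUy.
apply/seteqP; split=> z.
  move=> /(cU _ _ Ux)[s /= [ps <-{z}]].
  elim/last_ind: s ps => [_|s v IH]; first exact: side_refl.
  rewrite rcons_path last_rcons => /andP[/IH h /set_mem[Tv [_ Uv]]].
  by apply: (side_step h Tv) => vy; apply: nUy; rewrite -vy.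
move: z; apply: side_ind => // u v _ Uu Tuv vy; apply: contrapT => nUv.
have e1 : e = (x, y) by apply: ue.
have e2 : e = (u, v) by apply: ue.
by apply: vy; move: e2; rewrite e1 => -[].
Qed.

Hypothesis aT : acyclic T.

(** The form in which acyclicity is used: two distinct neighbours of [y] on the
    same side would close a cycle through [y]. *)
Lemma side_neighbour x y u : T (x, y) -> side x y u -> T (u, y) -> u = x.
Proof.
move=> Txy /(side_path (graph_neq Txy))[s [ps ls ys]] Tuy.
case: (shortenP ps) ls => s' ps' us' sub ls.
have ys' : y \notin x :: s'.
  by apply: contra ys; rewrite !inE => /orP[->//|/sub ->]; rewrite orbT.
have := @aT [:: y, x & s']; rewrite /ucycle /= => h.
have : (size s' <= 0)%N.
  apply: h; apply/andP; split; last by rewrite ys'.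
  rewrite rcons_path ps' ls /=; apply/andP; split; first by apply/mem_set; exact: graph_sym.
  exact/mem_set.
by rewrite leqn0 size_eq0 => /eqP s0; rewrite -ls s0.
Qed.

Lemma side_disjoint x y z : T (x, y) -> side x y z -> ~ side y x z.
Proof.
move=> Txy xz yz; have ne := graph_neq Txy; suff : ~ side x y z by [].
move: {xz} z yz; apply: side_ind; first by move=> /(side_avoid ne).
move=> u v yu nxu Tuv vx xv; apply: nxu.
have [uy|uy] := pselect (u = y); last exact: side_step xv (graph_sym Tuv) uy.
by case: vx; apply: (side_neighbour Txy xv); rewrite -uy; exact: graph_sym.
Qed.

Lemma conn_side x y : T (x, y) -> eclass (conn_rel T) x = side x y `|` side y x.
Proof.
move=> Txy; apply/seteqP; split=> z.
  move: z; apply: conn_ind; first by left; exact: side_refl.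
  move=> u v _ [h|h] Tuv.
    by have [->|vy] := pselect (v = y); [right; exact: side_refl|left; exact: side_step h Tuv vy].
  by have [->|vy] := pselect (v = x); [left; exact: side_refl|right; exact: side_step h Tuv vy].
case; first exact: side_conn.
by move=> /side_conn h; apply: conn_trans h; apply: conn_step (conn_refl x) Txy.
Qed.

Lemma side_sub x y w : T (x, y) -> T (w, x) -> w <> y -> side w x `<=` side x y.
Proof.
move=> Txy Twx wy; apply: side_ind.
  by apply: side_step (side_refl x y) (graph_sym Twx) wy.
move=> u v wu xu Tuv vx; apply: (side_step xu Tuv) => vy.
apply: (side_avoid (graph_neq Twx) wu).
by apply: (side_neighbour Txy xu); rewrite -vy.
Qed.

(** Whatever is not on the side of [x] away from [y] lies beyond [y], and from
    there the edge towards [y'] is not met. *)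
Lemma conn_two_sides x y y' : T (x, y) -> T (x, y') -> y <> y' ->
  eclass (conn_rel T) x = side x y `|` side x y'.
Proof.
move=> Txy Txy' yy'; apply/seteqP; split=> z.
  rewrite (conn_side Txy) => -[|yz]; first by left.
  by right; apply: side_sub (graph_sym Txy) _ _ yz.
by case; exact: side_conn.
Qed.

Lemma side_edge x y u v : T (x, y) -> T (u, v) -> side x y u -> ~ side x y v ->
  u = x /\ v = y.
Proof.
move=> Txy Tuv xu nxv.
have vy : v = y by apply: contrapT => vy; apply: nxv; exact: side_step xu Tuv vy.
by split => //; apply: side_neighbour Txy xu _; rewrite -vy.
Qed.

Lemma induced_conn_sym U x y :
  conn_rel (Defs.induced T U) (x, y) -> conn_rel (Defs.induced T U) (y, x).
Proof.
case=> s /= [ps <-{y}].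
elim: s x ps => [|v s IH] x /=; first by move=> _; exists [::].
move=> /andP[/set_mem[Txv [Ux Uv]] /IH [t /= [pt lt]]].
exists (rcons t x); rewrite last_rcons; split => //=.
by rewrite rcons_path pt lt; apply/mem_set; split; [exact: graph_sym|].
Qed.

Lemma side_half_space x y : T (x, y) -> half_space T (side x y).
Proof.
move=> Txy; have ne := graph_neq Txy.
have cx z : side x y z -> conn_rel (Defs.induced T (side x y)) (x, z).
  move: z; apply: side_ind; first by exists [::].
  move=> u v xu [s /= [ps ls]] Tuv vy; exists (rcons s v); rewrite last_rcons; split => //=.
  by rewrite rcons_path ps ls; apply/mem_set; split => //; split => //=; exact: side_step xu Tuv vy.
split.
  move=> u v /cx /induced_conn_sym [s /= [ps ls]] /cx [t /= [pt lt]].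
  by exists (s ++ t); rewrite /= cat_path ps last_cat ls pt.
exists (x, y); split => /=.
  split => //; first exact: side_refl.
  by move=> /(side_avoid ne).
by case=> u v /= [Tuv xu nxv]; have [-> ->] := side_edge Txy Tuv xu nxv.
Qed.

End reachability.

(** * Flows along edges *)

(** [D] is a relation such as the edges with a small side: a vertex has at most
    one outgoing edge in [D], and the edges behind an edge of [D] that point
    towards it are in [D] too. The map [g] follows [D] and fixes the vertices
    without outgoing edge. *)
Section flow.
Context (X : choiceType) (T : set (X * X)).
Hypotheses (gT : is_graph T) (aT : acyclic T).
Variables (D : X -> X -> Prop) (g : X -> X).
Hypothesis DT : forall x y, D x y -> T (x, y).
Hypothesis Dasym : forall x y, D x y -> ~ D y x.
Hypothesis Dback : forall x y w, D x y -> T (w, x) -> w <> y -> D w x.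
Hypothesis gD : forall x y, D x y -> g x = y.
Hypothesis gN : forall x, ~ D x (g x) -> g x = x.

(** On the side of [x] every vertex is sent one step closer to [x], since its edge
    towards [x] is in [D]. Conversely, a point that reaches [x] cannot do so by
    passing through [g x], as this would put the edge from [g x] to [x] into [D]. *)
Lemma flow_side x z : D x (g x) -> side T x (g x) z <-> exists k, iter k g z = x.
Proof.
move=> Dx; split.
  move=> xz; suff [k [ek _]] : exists k, iter k g z = x /\ forall j, (j <= k)%N -> D (iter j g z) (iter j.+1 g z).
    by exists k.
  move: z xz; apply: side_ind; first by exists 0%N; split => // -[].
  move=> u v _ [k [ku hk]] Tuv vgx.
  have [vgu|vgu] := pselect (v = g u).
    case: k ku hk => [/= ux|k ku hk]; first by case: vgx; rewrite vgu ux.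
    exists k; rewrite vgu -iterSr; split => // j jk.
    by rewrite -!iterSr; exact: hk.
  have Dvu : D v u by apply: (Dback (hk 0%N (leq0n _))) => //; exact: graph_sym.
  exists k.+1; rewrite iterSr (gD Dvu); split => // -[_|j jk]; first by rewrite /= (gD Dvu).
  by rewrite iterSr [X in D _ X]iterSr (gD Dvu); exact: hk.
case=> k; elim: k z => [|k IH] z; first by move=> /= ->; exact: side_refl.
rewrite iterSr => /IH xgz.
have [Dz|/gN gz] := pselect (D z (g z)); last by rewrite -gz.
apply: (side_step xgz (graph_sym gT (DT Dz))) => zgx.
have gzx : g z = x.
  by apply: (side_neighbour gT aT (DT Dx) xgz); rewrite -zgx; apply: graph_sym => //; exact: DT.
by apply: (Dasym Dx); move: Dz; rewrite gzx zgx.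
Qed.

Lemma flow_acyclic x k : D x (g x) -> iter k.+1 g x <> x.
Proof.
move=> Dx; rewrite iterSr => h.
have gg : side T x (g x) (g x) by apply/flow_side => //; exists k.
exact: (side_avoid (graph_neq gT (DT Dx)) gg erefl).
Qed.

Lemma flow_orbit_inj z i j : D (iter i g z) (iter i.+1 g z) ->
  D (iter j g z) (iter j.+1 g z) -> iter i g z = iter j g z -> i = j.
Proof.
wlog ij : i j / (i < j)%N.
  move=> H Di Dj e; have [/H|/H h|//] := ltngtP i j; first exact.
  by rewrite h.
move=> Di _; rewrite -(subnK ij) addnS -addSn iterD => e.
by case: (flow_acyclic Di (k := (j - i.+1)%N)).
Qed.

End flow.

(** * Sides along a ray *)
Section rays.
Context (X : choiceType) (T : set (X * X)).
Hypotheses (gT : is_graph T) (aT : acyclic T).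
Variable r : nat -> X.
Hypothesis ray : geodesic_ray T r.

Lemma ray_conn m n : conn_rel T (r m, r n).
Proof.
have h0 k : conn_rel T (r 0%N, r k).
  elim: k => [|k IH]; first exact: conn_refl.
  exact: conn_step IH (ray.2 k).
by apply: conn_trans (h0 n); exact: conn_sym.
Qed.

Lemma ray_side_tail n k : side T (r n.+1) (r n) (r (n.+1 + k)%N).
Proof.
elim: k => [|k IH]; first by rewrite addn0; exact: side_refl.
rewrite addnS; apply: (side_step IH (ray.2 _)) => /ray.1 e.
by have : (n.+1 + k).+1 = n := e; lia.
Qed.

Lemma ray_side_decr m n : (m <= n)%N -> side T (r n.+1) (r n) `<=` side T (r m.+1) (r m).
Proof.
move=> mn; rewrite -(subnK mn); elim: (n - m)%N => // k IH.
rewrite addSn; apply: subset_trans IH.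
apply: side_sub => //; try by apply: graph_sym => //; exact: ray.2.
by move=> /ray.1 e; have : (k + m).+2 = (k + m)%N := e; lia.
Qed.

(** Induction on the distance from the ray's origin: two adjacent vertices are on
    different sides of at most one edge of the ray. *)
Lemma ray_side_escape b : conn_rel T (r 0%N, b) ->
  exists m, forall n, (m <= n)%N -> ~ side T (r n.+1) (r n) b.
Proof.
have Tr n : T (r n.+1, r n) by apply: graph_sym => //; exact: ray.2.
move: b; apply: conn_ind.
  exists 0%N => n _ h; apply: (side_disjoint gT aT (Tr n) h).
  suff : forall k, (k <= n)%N -> side T (r n) (r n.+1) (r (n - k)%N).
    by move=> /(_ n (leqnn n)); rewrite subnn.
  elim=> [_|k IH kn]; first by rewrite subn0; exact: side_refl.
  apply: (side_step (IH (ltnW kn))).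
    have -> : (n - k)%N = (n - k.+1).+1 by lia.
    exact: Tr.
  by move=> /ray.1 e; have : (n - k.+1)%N = n.+1 := e; lia.
move=> u v cu [m hm] Tuv.
have [[k uk]|nk] := pselect (exists k, u = r k).
  exists (maxn m k.+1) => n; rewrite geq_max => /andP[mn kn] h.
  have [_ un] := side_edge gT aT (Tr n) (graph_sym gT Tuv) h (hm n mn).
  by have : k = n by [apply: ray.1; rewrite -uk]; lia.
exists m => n mn h; apply: nk; exists n.
by have [] := side_edge gT aT (Tr n) (graph_sym gT Tuv) h (hm n mn).
Qed.

(** Once the far side of the ray's edge misses the vertex just outside [U], no
    path inside it can leave [U]. *)
Lemma ray_half_space U m : half_space T U -> (forall n, (m <= n)%N -> U (r n)) ->
  exists k, forall n, (k <= n)%N -> side T (r n.+1) (r n) `<=` U.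
Proof.
move=> hU Ur; case: (hU) => cU [[a b] [/= [Tab Ua nUb] _]].
have conb : conn_rel T (r 0%N, b).
  have := cU _ _ (Ur m (leqnn _)) Ua => -[s /= [ps ls]].
  apply: conn_step _ Tab; apply: conn_trans (ray_conn 0 m) _.
  exists s; split => //=; apply: sub_path ps => u v /set_mem[Tuv _]; exact/mem_set.
have [k hk] := ray_side_escape conb.
exists (maxn k m) => n; rewrite geq_max => /andP[kn mn] z.
apply: side_ind; first by apply: Ur; exact: leqW.
move=> u v su Uu Tuv vr; apply: contrapT => nUv.
have UE := half_space_side hU Tab Ua nUb.
have [_ vb] : u = a /\ v = b by apply: (side_edge gT aT Tab Tuv); rewrite -UE.
by apply: (hk n kn); rewrite -vb; exact: side_step su Tuv vr.
Qed.

End rays.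

(** * Sums over classes and mass transport *)
Lemma standard_borel_separating (R : realType) (d : measure_display) (X : measurableType d) :
  standard_borel R X -> exists A : nat -> set X, (forall n, measurable (A n)) /\
    forall x y, (forall n, A n x -> A n y) -> x = y.
Proof.
move=> [P [f [[[D cD dD] _] [g fK gK] mf]]].
have [D0|[dl] hdl] : (D = set0) \/ exists dl : nat -> P, forall p, D p -> exists k, dl k = p.
  have /pfcard_geP[->|[h]] := cD; first by left.
  by right; exists h => p Dp; have [k _ <-] := 'surj_h Dp; exists k.
  exists (fun=> set0); split => // x; have [|p [_]] := dD setT _ openT; last by rewrite D0.
  by exists (f x).
pose B n := if unpickle n is Some (a, b) then closure (ball (dl a) b.+1%:R^-1) else setT.
exists (fun n => f @^-1` B n); split.
  move=> n; rewrite -[f @^-1` _]setCK preimage_setC; apply: measurableC; apply/mf.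
  rewrite (_ : f @` _ = ~` B n); last first.
    by apply/seteqP; split=> [_ [x Bx <-]//|p Bp]; exists (g p); rewrite /= ?gK.
  apply: sub_sigma_algebra => /=; rewrite openC /B; case: unpickle => [[a b]|]; last exact: closedT.
  exact: closed_closure.
move=> x y h; rewrite -[x]fK -[y]fK; congr g.
apply: (@metric_hausdorff R P) => U V Ux Vy.
exists (f y); split; last exact: nbhs_singleton.
have /nbhs_ballP[e /= e0 xe] := Ux; apply: xe.
have e2 : 0 < e / 2 / 2 by rewrite !divr_gt0.
have [n] := ltr_add_invr e2; rewrite add0r => ne.
have [|q [/interior_subset xq /hdl[k dk]]] := dD (ball (f x) n.+1%:R^-1)^° _ (open_interior _).
  by exists (f x); exact: nbhsx_ballx.
have : B (pickle (k, n)) (f y).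
  by apply: h; rewrite /B /= pickleK; apply: subset_closure; rewrite dk; exact: ball_sym.
rewrite /B pickleK => /closure_ball_double qy.
apply: (@ball_split _ _ q); first by apply: le_ball _ _ xq; apply: ltW (lt_le_trans ne _); rewrite ler_pdivrMr// ler_peMr ?divr_ge0 ?ltW// ltr1n.
rewrite -dk; apply: le_ball _ _ (qy _) => //.
by rewrite [leRHS]splitr lerD// ltW.
Qed.

Section borel_diagonal.
Context (R : realType) (d : measure_display) (X : measurableType d).
Hypothesis sX : standard_borel R X.

Lemma measurable_eq_fun (d' : measure_display) (Z : measurableType d') (f g : Z -> X) :
  measurable_fun setT f -> measurable_fun setT g -> measurable [set z | f z = g z].
Proof.
move=> mf mg; have [A [mA sepA]] := standard_borel_separating sX.
have -> : [set z | f z = g z] = \bigcap_n (~` (f @^-1` A n) `|` g @^-1` A n).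
  apply/seteqP; split=> z /=; first by move=> fg n _ /=; rewrite fg; case: (pselect (A n (g z))); [right|left].
  by move=> h; apply: sepA => n Afz; case: (h n I).
apply: bigcap_measurableType => n _; apply: measurableU.
  by apply: measurableC; rewrite -[X in measurable X]setTI; exact: mf.
by rewrite -[X in measurable X]setTI; exact: mg.
Qed.

End borel_diagonal.

(** Saturating and covering by a measurable null set are iterated alternately. *)
Lemma null_saturation (R : realType) (d : measure_display) (X : measurableType d)
    (mu : probability X R) (E : set (X * X)) (Z : set X) :
  (forall x, E (x, x)) -> (forall x y z, E (x, y) -> E (y, z) -> E (x, z)) ->
  mcp E mu -> mu.-negligible Z ->
  exists N, [/\ measurable N, mu N = 0%E, Z `<=` N & saturation E N = N].
Proof.
move=> Er Et mE nZ.
have [c hc] : {c : set X -> set X & forall A, mu.-negligible A ->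
    [/\ measurable (c A), mu (c A) = 0%E & A `<=` c A]}.
  apply: (@choice _ _ (fun A B => mu.-negligible A -> [/\ measurable B, mu B = 0%E & A `<=` B])) => A.
  by have [[B hB]|] := pselect (mu.-negligible A); [exists B|exists set0].
pose F := fix F n := if n is m.+1 then c (saturation E (F m)) else c Z.
have nF n : mu.-negligible (F n).
  elim: n => [|n IH] /=; first by have [m0 z0 _] := hc _ nZ; exists (c Z); split.
  by have [m0 z0 _] := hc _ (mE _ IH); exists (c (saturation E (F n))); split.
have mF n : measurable (F n).
  by case: n => [|n] /=; [have [] := hc _ nZ|have [] := hc _ (mE _ (nF n))].
have mU : measurable (\bigcup_n F n) by exact: bigcupT_measurable.
exists (\bigcup_n F n); split => //.
- by apply/negligibleP => //; exact: negligible_bigcup.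
- by move=> x Zx; exists 0%N => //; have [_ _] := hc _ nZ; exact.
- apply/seteqP; split=> [y [x [n _ Fx] Exy]|x Fx]; last by exists x.
  exists n.+1 => //; have [_ _] := hc _ (mE _ (nF n)); apply; by exists x.
Qed.

Section transport.
Context (R : realType) (d : measure_display) (X : measurableType d).
Variables (E : set (X * X)) (phi : nat -> X -> X) (N : set X).
Hypothesis sX : standard_borel R X.
Hypothesis mphi : forall i, measurable_fun setT (phi i).
Hypothesis phiE : forall x y, ~ N x -> E (x, y) -> exists i, phi i x = y.
Hypothesis mN : measurable N.
Hypothesis mE : measurable E.

(** [fresh l x] marks the first occurrence of a point in the enumeration of the
    class of [x], so that a sum over the class is a series over the fresh indices. *)
Definition fresh (l : nat) (x : X) := forall m, (m < l)%N -> phi m x <> phi l x.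

Lemma measurable_fresh l : measurable [set x | fresh l x].
Proof.
have -> : [set x | fresh l x] = \bigcap_(m in [set m | (m < l)%N]) ~` [set x | phi m x = phi l x].
  by apply/seteqP; split=> x h m /h.
by apply: bigcap_measurableType => m _; apply: measurableC; exact: (measurable_eq_fun sX).
Qed.

Lemma fresh_exists x y : ~ N x -> E (x, y) -> exists2 l, fresh l x & phi l x = y.
Proof.
move=> nN /(phiE nN) h; have [l pl lmin] := ex_minnP (P := fun i => `[< phi i x = y >])
   (let: ex_intro i hi := h in ex_intro _ i (asboolT hi)).
exists l; last exact/asboolP.
move=> m ml e; have : (l <= m)%N by apply: lmin; apply/asboolP; rewrite e; exact/asboolP.
by rewrite leqNgt ml.
Qed.

Lemma esum_fresh x (f : X -> \bar R) : ~ N x -> (forall y, (0 <= f y)%E) ->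
  (forall y, f y <> 0%E -> E (x, y)) ->
  \esum_(y in setT) f y =
  (\sum_(0 <= l <oo) (if `[< fresh l x >] then f (phi l x) else 0))%E.
Proof.
move=> nN f0 fE.
transitivity (\esum_(y in [set phi l x | l in [set l | fresh l x]]) f y)%E.
  rewrite [RHS]esum_mkcond; apply: eq_esum => y _; case: ifPn => // /negP h.
  apply: contrapT => fy; apply: h; apply/mem_set.
  by have [l fl <-] := fresh_exists nN (fE y fy); exists l.
rewrite esum_image; last first.
  move=> i j /set_mem fi /set_mem fj e; have [ij|ij|//] := ltngtP i j.
    by case: (fj i ij).
  by case: (fi j ij).
rewrite esum_mkcond -nneseries_esumT; last by move=> n; case: ifP.
apply: eq_eseriesr => l _; congr (if _ then _ else _).
Qed.

Lemma measurable_enumerated_esum (f : X -> X -> \bar R) : (forall x y, (0 <= f x y)%E) ->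
  (forall x y, f x y <> 0%E -> E (x, y)) ->
  (forall l, measurable_fun (~` N) (fun x => f x (phi l x))) ->
  measurable_fun (~` N) (fun x => \esum_(y in setT) f x y).
Proof.
move=> f0 fE mf.
apply: (@eq_measurable_fun _ _ _ _ _ (fun x => \sum_(0 <= l <oo)
   (if `[< fresh l x >] then f x (phi l x) else 0))%E).
  by move=> x /set_mem nN; rewrite (esum_fresh nN (f0 x) (fE x)).
apply: ge0_emeasurable_sum; first by move=> l x _ _; case: ifP.
move=> l _; have mY : measurable (~` N) by exact: measurableC.
have mb : measurable_fun (~` N) (fun x => `[< fresh l x >]).
  apply: (measurable_fun_bool true) => //.
  rewrite (_ : _ `&` _ = ~` N `&` [set x | fresh l x]); first exact: measurableI (measurable_fresh l).
  by apply/seteqP; split=> x [nx /asboolP h]; split => //; exact/asboolP.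
apply: (measurable_fun_if mY mb); last exact: measurable_cst.
by apply: (measurable_funS mY _ (mf l)) => x [].
Qed.

Lemma measurable_class_esum (h : X * X -> \bar R) : measurable_fun setT h ->
  (forall p, (0 <= h p)%E) -> (forall p, h p <> 0%E -> E p /\ ~ N p.1) ->
  measurable_fun setT (fun x => \esum_(y in setT) h (x, y)).
Proof.
move=> mh h0 hE; have mY : measurable (~` N) by exact: measurableC.
have -> : (fun x => \esum_(y in setT) h (x, y)) = (fun x => \esum_(y in setT) h (x, y)) \_ (~` N).
  apply/funext => x; rewrite patchE; case: ifPn => // /negP nx.
  apply: esum1 => y _; apply: contrapT => /hE[_ /= xN]; apply: nx; exact/mem_set.
apply/(measurable_restrict _ mY measurableT); rewrite setTI.
apply: measurable_enumerated_esum => //; first by move=> x y /hE[].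
move=> l; apply: measurable_funTS.
by apply: (measurableT_comp mh); apply: measurable_fun_pair => //; exact: measurable_id.
Qed.

(** The defining identity of the cocycle, for a function on all of [X * X] that
    vanishes off [E]. *)
Lemma mass_transport (mu : probability X R) rho (h : X * X -> \bar R) :
  RN_cocycle E mu rho -> measurable_fun setT h ->
  (forall p, (0 <= h p)%E) -> (forall p, h p <> 0%E -> E p) ->
  (forall x y, E (x, y) -> E (y, x)) ->
  (\int[mu]_x (\esum_(y in setT) h (x, y)) =
   \int[mu]_x (\esum_(y in setT) (h (y, x) * (rho (y, x))%:E)))%E.
Proof.
move=> [_ _ _ ident] mh h0 hE Es.
have := ident h; rewrite /borel_on => /(_ (conj mE (measurable_funTS mh)) (fun p _ => h0 p)) H.
transitivity (\int[mu]_x \esum_(y in eclass E x) h (x, y))%E.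
  apply: eq_integral => x _; rewrite [RHS]esum_mkcond; apply: eq_esum => y _.
  case: ifPn => // /negP ny; apply: contrapT => /hE h'; apply: ny; exact/mem_set.
rewrite H; apply: eq_integral => x _; rewrite esum_mkcond; apply: eq_esum => y _.
case: ifPn => // /negP ny; suff -> : h (y, x) = 0%E by rewrite mul0e.
by apply: contrapT => /hE h'; apply: ny; apply/mem_set; exact: Es.
Qed.

Lemma measurable_swapped (mu : probability X R) rho (h : X * X -> \bar R) :
  RN_cocycle E mu rho -> measurable_fun setT h ->
  (forall p, h p <> 0%E -> E p) ->
  measurable_fun setT (fun p => h (p.2, p.1) * (rho (p.2, p.1))%:E)%E.
Proof.
move=> [[_ mrho] _ _ _] mh hE.
have -> : (fun p => h (p.2, p.1) * (rho (p.2, p.1))%:E)%E =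
   (fun p => h p * (EFin \o (rho \_ E)) p)%E \o (fun p => (p.2, p.1)).
  apply/funext => -[x y] /=; rewrite patchE; case: ifPn => // /negP nE.
  suff -> : h (y, x) = 0%E by rewrite !mul0e.
  by apply: contrapT => /hE h'; apply: nE; exact/mem_set.
apply: measurableT_comp; last first.
  by apply: measurable_fun_pair; [exact: measurable_snd|exact: measurable_fst].
apply: emeasurable_funM => //; apply/measurable_EFinP.
by apply/(measurable_restrict _ mE measurableT); rewrite setTI.
Qed.

End transport.

Lemma ae_lty (R : realType) (d : measure_display) (X : measurableType d)
    (mu : probability X R) (f : X -> \bar R) :
  measurable_fun setT f -> (forall x, (0 <= f x)%E) -> (\int[mu]_x f x < +oo)%E ->
  mu.-negligible [set x | ~ (f x < +oo)%E].
Proof.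
move=> mf f0 fi.
have /(integrable_ae measurableT) h : mu.-integrable setT f.
  by apply/integrableP; split => //; under eq_integral => x _ do rewrite gee0_abs//.
by apply: negligibleS h => x /= nf /(_ I) /fin_numPlt; rewrite ltNye_eq => /andP[].
Qed.

(** * Backward orbits of a Borel flow *)
Lemma countable_class (X : choiceType) (T : set (X * X)) x :
  locally_countable T -> countable (eclass (conn_rel T) x).
Proof.
move=> lc; pose F := fix F n : set X := if n is m.+1 then \bigcup_(u in F m) [set v | T (u, v)] else [set x].
have cF n : countable (F n).
  by elim: n => [|n IH] /=; [exact: countable1|exact: bigcup_countable].
apply: (@sub_countable _ _ _ (\bigcup_n F n)); last exact: bigcup_countable.
apply: subset_card_le; apply: conn_ind; first by exists 0%N.
by move=> u v _ [n _ Fu] Tuv; exists n.+1 => //=; exists u.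
Qed.

Lemma class_enumeration (R : realType) (d : measure_display) (X : measurableType d)
    (mu : probability X R) (T : set (X * X)) :
  standard_borel R X -> is_graph T -> locally_countable T -> measurable (conn_rel T) ->
  mcp (conn_rel T) mu ->
  exists (phi : nat -> X -> X) (N : set X),
    [/\ forall i, measurable_fun setT (phi i), forall i x, conn_rel T (x, phi i x),
        forall x y, ~ N x -> conn_rel T (x, y) -> exists i, phi i x = y,
        measurable N & mu N = 0%E /\ saturation (conn_rel T) N = N].
Proof.
move=> sX gT lc mE mcpT.
have [phi [M [nM mphi hphi]]] := standard_borel_enumeration mu sX mE (fun x => countable_class x lc).
have [N [mN N0 MN NN]] := null_saturation (@conn_refl _ T)
  (fun x y z => @conn_trans _ T x y z) mcpT nM.
exists (fun i x => if `[< conn_rel T (x, phi i x) >] then phi i x else x), N; split => //.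
- move=> i; apply: measurable_fun_ifT => //.
  apply: (measurable_fun_bool true); rewrite setTI.
  have -> : (fun x => `[< conn_rel T (x, phi i x) >]) @^-1` [set true] = (fun x => (x, phi i x)) @^-1` conn_rel T.
    by apply/seteqP; split=> x /asboolP h; exact/asboolP || exact: h.
  rewrite -[X in measurable X]setTI.
  by apply: (measurable_fun_pair (f := id) _ (mphi i)) => //; exact: measurable_id.
- by move=> i x; case: asboolP => // _; exact: conn_refl.
- move=> x y nx Exy; have [|i hi] := hphi x y _ Exy; first by move=> /MN.
  by exists i; rewrite hi; case: asboolP.
Qed.

Lemma dominates_negligible (R : realType) (d : measure_display) (X : measurableType d)
    (mu nu : probability X R) (Z : set X) :
  nu `<< mu -> mu.-negligible Z -> nu.-negligible Z.
Proof.
move=> /null_content_dominatesP numu [A [mA A0 ZA]]; exists A; split => //.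
exact: numu.
Qed.

Section flow_transport.
Context (R : realType) (d : measure_display) (X : measurableType d).
Context (T : set (X * X)) (phi : nat -> X -> X) (N : set X).
Hypothesis sX : standard_borel R X.
Hypotheses (gT : is_graph T) (aT : acyclic T) (mT : measurable T).
Hypothesis mE : measurable (conn_rel T).
Hypothesis mphi : forall i, measurable_fun setT (phi i).
Hypothesis Ephi : forall i x, conn_rel T (x, phi i x).
Hypothesis phiE : forall x y, ~ N x -> conn_rel T (x, y) -> exists i, phi i x = y.
Hypothesis mN : measurable N.
Hypothesis NN : saturation (conn_rel T) N = N.

Lemma outside_class x y : conn_rel T (x, y) -> ~ N x -> ~ N y.
Proof.
by move=> xy nx Ny; apply: nx; rewrite -NN; exists y => //; apply: (conn_sym gT).
Qed.

Lemma measurable_comp_pair (A : set (X * X)) (f g : X -> X) : measurable A ->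
  measurable_fun setT f -> measurable_fun setT g -> measurable [set x | A (f x, g x)].
Proof.
move=> mA mf mg; have := measurable_fun_pair mf mg measurableT mA.
by rewrite setTI.
Qed.

(** The vertices of a path from [x] belong to the class of [x], so the path can be
    described by indices of the enumeration. *)
Lemma measurable_side i j :
  measurable [set x | ~ N x /\ side T x (phi i x) (phi j x)].
Proof.
have mY : measurable (~` N) by exact: measurableC.
have mid := @measurable_id _ X setT.
suff mr n : forall j, measurable (~` N `&` [set x | reach T x (phi i x) n (phi j x)]).
  rewrite (_ : [set x | _] = \bigcup_n (~` N `&` [set x | reach T x (phi i x) n (phi j x)])).
    exact: bigcupT_measurable.
  apply/seteqP; split=> x; first by case=> nx [n _ h]; exists n.
  by case=> n _ [nx h]; split => //; exists n.
elim: n => [|n IH] k.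
  by apply: measurableI => //; exact: (measurable_eq_fun sX).
rewrite (_ : _ `&` _ = \bigcup_l ((~` N `&` [set x | reach T x (phi i x) n (phi l x)]) `&`
   ([set x | T (phi l x, phi k x)] `&` ~` [set x | phi k x = phi i x]))).
  apply: bigcupT_measurable => l; apply: measurableI => //; apply: measurableI.
    exact: measurable_comp_pair.
  by apply: measurableC; exact: (measurable_eq_fun sX).
apply/seteqP; split=> x.
  case=> nx [u [hu Tu ne]]; have [|l lu] := phiE nx (_ : conn_rel T (x, u)).
    by apply: (@side_conn _ T x (phi i x)); exists n.
  by exists l => //; rewrite /= lu.
by case=> l _ [[nx h] [Tl ne]]; split => //; exists (phi l x).
Qed.

Variable D : X -> X -> Prop.
Hypothesis mD : forall i, measurable [set x | D x (phi i x)].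
Hypothesis DN : forall x y, D x y -> ~ N x.
Hypothesis DT : forall x y, D x y -> T (x, y).
Hypothesis Duniq : forall x y y', D x y -> D x y' -> y = y'.

Lemma flow_dom_phi x y : D x y -> exists i, D x (phi i x).
Proof.
move=> Dxy; have [|i iy] := phiE (DN Dxy) (_ : conn_rel T (x, y)).
  exact: conn_step (conn_refl T x) (DT Dxy).
by exists i; rewrite iy.
Qed.

Lemma flow_map : exists g : X -> X, [/\ measurable_fun setT g,
  forall x y, D x y -> g x = y, forall x, ~ D x (g x) -> g x = x &
  measurable [set x | D x (g x)]].
Proof.
have [g hg] : {g : X -> X & forall x, D x (g x) \/ (forall y, ~ D x y) /\ g x = x}.
  apply: (@choice _ _ (fun x z => D x z \/ (forall y, ~ D x y) /\ z = x)) => x.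
  have [[y Dy]|h] := pselect (exists y, D x y); first by exists y; left.
  by exists x; right; split => // y Dy; apply: h; exists y.
have gD x y : D x y -> g x = y.
  by move=> Dxy; case: (hg x) => [h|[/(_ y)]//]; exact: Duniq h Dxy.
have VE : [set x | D x (g x)] = \bigcup_i [set x | D x (phi i x)].
  apply/seteqP; split=> x; first by move=> /flow_dom_phi[i]; exists i.
  by case=> i _ /= h; rewrite (gD _ _ h).
have mV : measurable [set x | D x (g x)] by rewrite VE; exact: bigcupT_measurable.
exists g; split => //; last by move=> x nD; case: (hg x) => [//|[]].
move=> _ B mB; rewrite setTI.
rewrite (_ : g @^-1` B = \bigcup_i ([set x | D x (phi i x)] `&` phi i @^-1` B) `|`
   (~` [set x | D x (g x)] `&` B)).
  apply: measurableU; last by apply: measurableI => //; exact: measurableC.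
  apply: bigcupT_measurable => i; apply: measurableI => //.
  by rewrite -[X in measurable X]setTI; exact: mphi.
apply/seteqP; split=> x /=.
  case: (hg x) => [Dg Bg|[nD ->] Bx]; last by right.
  by left; have [i Di] := flow_dom_phi Dg; exists i => //; split => //=; rewrite -(gD _ _ Di).
case=> [[i _ [Di Bi]]|[nD Bx]]; first by rewrite /= (gD _ _ Di).
by case: (hg x) => [//|[_ ->]].
Qed.

Hypothesis Dasym : forall x y, D x y -> ~ D y x.
Hypothesis Dback : forall x y w, D x y -> T (w, x) -> w <> y -> D w x.
Variable g : X -> X.
Hypothesis mg : measurable_fun setT g.
Hypothesis gD : forall x y, D x y -> g x = y.
Hypothesis gN : forall x, ~ D x (g x) -> g x = x.
Hypothesis mV : measurable [set x | D x (g x)].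

(** The point [p.2] lies on the side of [p.1] away from [g p.1] ([upstream_side]);
    iterates of [g] make this visibly a Borel relation. *)
Definition upstream : set (X * X) := [set p | D p.1 (g p.1) /\ exists k, iter k g p.2 = p.1].

Lemma upstream_side x : D x (g x) -> [set z | upstream (x, z)] = side T x (g x).
Proof.
move=> Dx; have fs := flow_side gT aT DT Dasym Dback gD gN _ Dx.
by apply/seteqP; split=> z; [case=> _ /fs|move=> /fs].
Qed.

Lemma upstream_conn x z : upstream (x, z) -> conn_rel T (x, z).
Proof.
move=> h; have Dx : D x (g x) by case: h.
by apply: (@side_conn _ T x (g x)); rewrite -upstream_side.
Qed.

Lemma upstream_null x z : upstream (x, z) -> ~ N x.
Proof. by case=> /DN. Qed.

Lemma upstream_trans x y z : upstream (x, y) -> upstream (y, z) -> upstream (x, z).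
Proof.
by case=> /= Dx [k ky] [/= Dy [l lz]]; split => //=; exists (k + l)%N; rewrite iterD lz.
Qed.

Lemma upstream_anti x y : upstream (x, y) -> upstream (y, x) -> x = y.
Proof.
case=> /= Dx [k ky] [/= Dy [l lx]]; case: k ky => [//|k ky].
have : iter (k + l).+1 g x = x by rewrite -addSn iterD lx.
by move/(flow_acyclic gT aT DT Dasym Dback gD gN Dx).
Qed.

(** Both points are on the forward orbit of [z]. *)
Lemma upstream_chain x y z : upstream (x, z) -> upstream (y, z) ->
  upstream (x, y) \/ upstream (y, x).
Proof.
case=> /= Dx [k kz] [/= Dy [l lz]].
have [kl|lk] := leqP k l.
  by right; split => //; exists (l - k)%N; rewrite -kz -iterD subnK.
by left; split => //; exists (k - l)%N; rewrite -lz -iterD subnK// ltnW.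
Qed.

Lemma upstream_refl x : D x (g x) -> upstream (x, x).
Proof. by split => //; exists 0%N. Qed.

Lemma measurable_iter k : measurable_fun setT (iter k g).
Proof.
elim: k => [|k IH]; first exact: measurable_id.
rewrite (_ : iter k.+1 g = g \o iter k g) //; exact: measurableT_comp.
Qed.

Lemma measurable_upstream : measurable upstream.
Proof.
rewrite (_ : upstream = fst @^-1` [set x | D x (g x)] `&`
   \bigcup_k [set p : X * X | (iter k g \o snd) p = p.1]); last first.
  apply/seteqP; split=> -[x z] /=; first by case=> Dx [k h]; split => //; exists k.
  by case=> Dx [k _ h]; split => //; exists k.
apply: measurableI.
  by rewrite -[X in measurable X]setTI; exact: measurable_fst.
apply: bigcupT_measurable => k; apply: (measurable_eq_fun sX).
  by apply: measurableT_comp; [exact: measurable_iter|exact: measurable_snd].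
exact: measurable_fst.
Qed.

(** The mass behind [x], as seen from [x]. *)
Definition upsum (rho : X * X -> R) x : \bar R :=
  \esum_(z in [set z | upstream (x, z)]) (rho (z, x))%:E.

Definition hits (K : set X) : set (X * X) := [set p | K p.2 /\ upstream (p.2, p.1)].

(** The number of points of [K] on the forward orbit of [x], among those moved by [g]. *)
Definition visits (K : set X) x : \bar R := \esum_(y in setT) (cst 1%E \_ (hits K)) (x, y).

Lemma measurable_hits K : measurable K -> measurable (hits K).
Proof.
move=> mK; rewrite (_ : hits K = snd @^-1` K `&` (fun p => (p.2, p.1)) @^-1` upstream) //.
apply: measurableI; first by rewrite -[X in measurable X]setTI; exact: measurable_snd.
rewrite -[X in measurable X]setTI.
apply: (measurable_fun_pair (f := snd) (g := fst)) => //; last exact: measurable_upstream.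
Qed.

Lemma measurable_hits_ind K : measurable K ->
  measurable_fun setT ((cst 1%E : X * X -> \bar R) \_ (hits K)).
Proof.
move=> mK; apply/(measurable_restrict _ (measurable_hits mK) measurableT).
exact: measurable_cst.
Qed.

Lemma hits_ge0 K p : (0 <= ((cst 1%E : X * X -> \bar R) \_ (hits K)) p)%E.
Proof. by rewrite patchE; case: ifP. Qed.

Lemma hits_conn K p : ((cst 1%E : X * X -> \bar R) \_ (hits K)) p <> 0%E -> conn_rel T p.
Proof.
rewrite patchE; case: ifP => // /set_mem; case: p => x y [_ /= /upstream_conn h] _.
exact: (conn_sym gT).
Qed.

Lemma hits_outside K p : ((cst 1%E : X * X -> \bar R) \_ (hits K)) p <> 0%E ->
  conn_rel T p /\ ~ N p.1.
Proof.
move=> h; have c := hits_conn h; split => //; move: h.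
rewrite patchE; case: ifP => // /set_mem; case: p c => x y c [_ /= u] _.
exact: outside_class (upstream_conn u) (upstream_null u).
Qed.

Lemma measurable_visits K : measurable K -> measurable_fun setT (visits K).
Proof.
move=> mK; apply: (measurable_class_esum sX mphi phiE mN (h := cst 1%E \_ (hits K))).
- exact: measurable_hits_ind.
- exact: hits_ge0.
- exact: hits_outside.
Qed.

Lemma visits_ge0 K x : (0 <= visits K x)%E.
Proof. by apply: esum_ge0 => y _; exact: hits_ge0. Qed.

Section cocycle.
Variables (mu : probability X R) (rho : X * X -> R).
Hypothesis hrho : RN_cocycle (conn_rel T) mu rho.

Lemma upsum_hits K x : \esum_(y in setT) ((cst 1%E \_ (hits K)) (y, x) * (rho (y, x))%:E)%E =
  (upsum rho \_ K) x.
Proof.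
rewrite [RHS]patchE; case: ifPn => [/set_mem Kx|/negP nK]; last first.
  apply: esum1 => y _; rewrite patchE; case: ifP; last by rewrite mul0e.
  by move=> /set_mem[/= Kx _]; case: nK; exact/mem_set.
rewrite /upsum [RHS]esum_mkcond; apply: eq_esum => y _; rewrite patchE.
have -> : ((y, x) \in hits K) = (y \in [set z | upstream (x, z)]).
  by apply/idP/idP => /set_mem h; apply/mem_set; [case: h|split].
by case: ifP; rewrite ?mul1e ?mul0e.
Qed.

Lemma measurable_upsum_patch K : measurable K -> measurable_fun setT (upsum rho \_ K).
Proof.
move=> mK; rewrite (_ : upsum rho \_ K = fun x => \esum_(y in setT)
    ((fun p => (cst 1%E \_ (hits K)) (p.2, p.1) * (rho (p.2, p.1))%:E) (x, y))%E); last first.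
  by apply/funext => x; rewrite -upsum_hits.
apply: (measurable_class_esum sX mphi phiE mN
  (h := fun p => (cst 1%E \_ (hits K)) (p.2, p.1) * (rho (p.2, p.1))%:E)%E).
- apply: (measurable_swapped mE hrho) => //; [exact: measurable_hits_ind|exact: hits_conn].
- move=> [x y] /=; have := hits_ge0 K (y, x); rewrite patchE; case: ifPn; last by rewrite mul0e.
  move=> /set_mem[_ /= u] _; rewrite mul1e lee_fin; case: hrho => _ h _ _.
  by apply: ltW; apply: h; apply: (conn_sym gT); exact: upstream_conn.
- move=> [x y] /=; rewrite patchE; case: ifPn; last by rewrite mul0e.
  by move=> /set_mem[_ /= u] _; split; [exact: upstream_conn|exact: upstream_null u].
Qed.

Lemma upsum_ge0 x : (0 <= upsum rho x)%E.
Proof.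
apply: esum_ge0 => z u; rewrite lee_fin; case: hrho => _ h _ _.
by apply: ltW; apply: h; apply: (conn_sym gT); exact: upstream_conn.
Qed.

Lemma upsum_patch_ge0 K x : (0 <= (upsum rho \_ K) x)%E.
Proof. by rewrite patchE; case: ifP => // _; exact: upsum_ge0. Qed.

(** Counting pairs (x, y) with [y] in [K] and [x] behind [y], once from [x] and once
    from [y]. *)
Lemma visits_transport K : measurable K ->
  (\int[mu]_x visits K x = \int[mu]_(x in K) upsum rho x)%E.
Proof.
move=> mK; rewrite /visits (mass_transport mE hrho)//; last 4 first.
- exact: measurable_hits_ind.
- exact: hits_ge0.
- exact: hits_conn.
- by move=> x y; exact: (conn_sym gT).
rewrite [RHS]integral_mkcond; apply: eq_integral => x _; exact: upsum_hits.
Qed.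

End cocycle.

(** The forward orbit of [x] counts [x] itself, which the orbit of a later point
    does not. *)
Lemma visits_lt K x y : K x -> upstream (y, x) -> x <> y ->
  (1 + visits K y <= visits K x)%E.
Proof.
move=> Kx xy ne; have ux : upstream (x, x).
  apply: upstream_refl; apply: contrapT => nD; apply: ne.
  case: xy => _ [k /= <-]; elim: k => //= k IH.
  by rewrite -IH (gN nD).
have E1 : \esum_(z in setT) (if z == x then 1%E else 0%E) = 1%E :> \bar R.
  transitivity (\esum_(z in [set x]) (1%E : \bar R)); last by rewrite esum_set1.
  rewrite [RHS]esum_mkcond; apply: eq_esum => z _.
  by congr (if _ then _ else _); apply/idP/idP => [/eqP ->|/set_mem ->//]; exact/mem_set.
rewrite -[X in (X + _)%E]E1 -esumD; last 2 first.
- by move=> z _; case: ifP.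
- by move=> z _; exact: hits_ge0.
apply: le_esum => z _; rewrite !patchE; case: eqVneq => [->|zx].
  rewrite ifF; first by rewrite ifT ?adde0//; apply/mem_set.
  by apply/negP => /set_mem[_ /= h]; apply: ne; exact: upstream_anti.
rewrite add0e; case: ifPn => [/set_mem[Kz u]|_]; last by case: ifP.
by rewrite ifT//; apply/mem_set; split => //=; exact: upstream_trans u xy.
Qed.

Lemma visits_le1 K x : (forall y z, K y -> K z -> upstream (y, z) -> y = z) ->
  (visits K x <= 1)%E.
Proof.
move=> hK; have [[y [Ky yx]]|h] := pselect (exists y, K y /\ upstream (y, x)); last first.
  rewrite /visits esum1// => z _; rewrite patchE; case: ifP => // /set_mem[Kz u].
  by case: h; exists z.
have <- : \esum_(z in [set y]) (1%E : \bar R) = 1%E by rewrite esum_set1.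
rewrite [leRHS]esum_mkcond; apply: le_esum => z _.
rewrite patchE; case: ifPn => [/set_mem[/= Kz zx]|_]; last by case: ifP.
rewrite ifT//; apply/mem_set => /=.
by case: (upstream_chain yx zx) => [/(hK _ _ Ky Kz)|/(hK _ _ Kz Ky)].
Qed.

(** Hopf decomposition: [visits (Vk k)] has integral at most [k] for [mu], hence is
    finite. Along a forward orbit it drops by at least one after each point of
    [Vk k], so the orbit meets the set [A k j] at most once, and [upsum rhon] has
    integral at most one over [A k j] for [nu]. *)
Lemma upsum_finite (mu nu : probability X R) (rhom rhon : X * X -> R) :
  nu `<< mu -> RN_cocycle (conn_rel T) mu rhom -> RN_cocycle (conn_rel T) nu rhon ->
  (forall x, D x (g x) -> (upsum rhom x < +oo)%E) ->
  nu.-negligible [set x | D x (g x) /\ ~ (upsum rhon x < +oo)%E].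
Proof.
move=> numu hm hn fin.
pose V := [set x | D x (g x)].
pose Vk k : set X := [set x | V x /\ (upsum rhom x <= k%:R%:E)%E].
have mVk k : measurable (Vk k).
  rewrite (_ : Vk k = V `&` (upsum rhom \_ V) @^-1` [set` `]-oo, (k%:R%:E : \bar R)]]); last first.
    by apply/seteqP; split=> x [Vx]; rewrite /= in_itv /= patchE ifT//; exact/mem_set.
  apply: measurableI => //; rewrite -[X in measurable X]setTI.
  by apply: (measurable_upsum_patch hm mV) => //; exact: emeasurable_itv.
have visk k : mu.-negligible [set x | ~ (visits (Vk k) x < +oo)%E].
  apply: ae_lty; [exact: measurable_visits|exact: visits_ge0|].
  rewrite (visits_transport hm)//.
  apply: (@le_lt_trans _ _ (\int[mu]_(x in setT) (cst k%:R%:E x))%E).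
    rewrite integral_mkcond; apply: ge0_le_integral => //.
    - by move=> x _; exact: (upsum_patch_ge0 hm).
    - exact: (measurable_upsum_patch hm).
    - by move=> x _; rewrite patchE; case: ifPn => [/set_mem[]//|_]; rewrite lee_fin.
  by rewrite integral_cst// -[X in (_ * X)%E]/(mu setT) probability_setT mule1 ltry.
pose A k j : set X := [set x | Vk k x /\ (j%:R%:E <= visits (Vk k) x < j.+1%:R%:E)%E].
have mA k j : measurable (A k j).
  rewrite (_ : A k j = Vk k `&` visits (Vk k) @^-1` [set` `[(j%:R%:E : \bar R), j.+1%:R%:E[]); last first.
    by apply/seteqP; split=> x [Vx h]; split => //=; move: h; rewrite /= in_itv.
  apply: measurableI => //; rewrite -[X in measurable X]setTI.
  by apply: (measurable_visits (mVk k)) => //; exact: emeasurable_itv.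
have nA k j : nu.-negligible [set x | ~ ((upsum rhon \_ (A k j)) x < +oo)%E].
  apply: ae_lty; [exact: (measurable_upsum_patch hn (mA k j))|exact: (upsum_patch_ge0 hn)|].
  rewrite -integral_mkcond -(visits_transport hn)//.
  apply: (@le_lt_trans _ _ (\int[nu]_(x in setT) (cst 1%E x))%E).
    apply: ge0_le_integral => //.
    - by move=> x _; exact: visits_ge0.
    - exact: measurable_visits.
    - move=> x _; apply: visits_le1 => y z [Vy /andP[yj _]] [Vz /andP[_ zj]] yz.
      apply: contrapT => ne; have := visits_lt Vz yz (fun e => ne (esym e)).
      move=> /le_lt_trans/(_ zj); rewrite ltNge => /negP; apply.
      have -> : j.+1%:R%:E = (1 + j%:R%:E)%E :> \bar R by rewrite -EFinD nat1r.
      exact: leeD2l.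
  by rewrite integral_cst// -[X in (_ * X)%E]/(nu setT) probability_setT mule1 ltry.
have nvis k : nu.-negligible [set x | ~ (visits (Vk k) x < +oo)%E].
  exact: dominates_negligible numu (visk k).
apply: (@negligibleS _ _ _ _ ((\bigcup_k [set x | ~ (visits (Vk k) x < +oo)%E]) `|`
   \bigcup_k \bigcup_j [set x | ~ ((upsum rhon \_ (A k j)) x < +oo)%E])); last first.
  apply: negligibleU; first exact: negligible_bigcup.
  by apply: negligible_bigcup => k; exact: negligible_bigcup.
move=> x [Vx inf]; have [k kx] : exists k, Vk k x.
  have := fin x Vx; have := upsum_ge0 hm x.
  case xr : (upsum rhom x) => [r| |] //; rewrite lee_fin => r0 _.
  exists (Num.bound r); split => //; rewrite xr lee_fin.
  by apply: ltW; exact: archi_boundP.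
have [fv|nf] := pselect (visits (Vk k) x < +oo)%E; last by left; exists k.
right; exists k => //.
have [j jx] : exists j, (j%:R%:E <= visits (Vk k) x < j.+1%:R%:E)%E.
  move: fv; have := visits_ge0 (Vk k) x.
  case: visits => // r; rewrite lee_fin => r0 _; exists (Num.truncn r).
  by rewrite lee_fin lte_fin; exact: truncn_itv.
by exists j => //=; rewrite patchE ifT//; apply/mem_set.
Qed.

End flow_transport.

(** * Masses of subsets of a class *)
Section esum_facts.
Context (R : realType) (X : choiceType).
Implicit Types (A B : set X) (a : X -> \bar R).

Lemma esumZr_le A a (c : R) : 0 <= c -> (forall i, A i -> (0 <= a i)%E) ->
  (\esum_(i in A) (a i * c%:E) <= (\esum_(i in A) a i) * c%:E)%E.
Proof.
move=> c0 a0; pose b i := if i \in A then a i else 0%E.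
have b0 i : (0 <= b i)%E by rewrite /b; case: ifPn => // /set_mem; exact: a0.
have bE i : A i -> a i = b i by move=> Ai; rewrite /b ifT//; exact/mem_set.
rewrite (eq_esum (b := fun i => b i * c%:E)%E); last by move=> i /bE ->.
rewrite [in leRHS](eq_esum (b := b)) => [|i /bE//].
apply: ge_ereal_sup => _ [F [finF FA] <-].
rewrite -ge0_mule_fsuml//.
by apply: lee_wpmul2r; rewrite ?lee_fin//; apply: ereal_sup_ubound; exists F.
Qed.

Lemma esumZr A a (c : R) : 0 < c -> (forall i, A i -> (0 <= a i)%E) ->
  (\esum_(i in A) (a i * c%:E) = (\esum_(i in A) a i) * c%:E)%E.
Proof.
move=> c0 a0; apply/eqP; rewrite eq_le; apply/andP; split; first exact: (esumZr_le (ltW c0) a0).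
have ci : 0 < c^-1 by rewrite invr_gt0.
have ac0 i : A i -> (0 <= a i * c%:E)%E.
  by move=> Ai; apply: mule_ge0; [exact: a0|rewrite lee_fin ltW].
have := esumZr_le (ltW ci) ac0; rewrite (_ : \esum_(i in A) _ = \esum_(i in A) a i); last first.
  by apply: eq_esum => i _; rewrite -muleA -EFinM mulfV ?mule1// gt_eqF.
by rewrite lee_pdivlMr.
Qed.

Lemma sub_esum A B a : A `<=` B -> (forall i, B i -> (0 <= a i)%E) ->
  (\esum_(i in A) a i <= \esum_(i in B) a i)%E.
Proof.
move=> AB a0; rewrite [leLHS]esum_mkcond [leRHS]esum_mkcond; apply: le_esum => i _.
case: ifPn => [iA|_]; first by rewrite ifT//; apply/mem_set/AB/set_mem.
by case: ifPn => // iB; apply/a0/set_mem.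
Qed.

Lemma esumU_le A B a : (forall i, (A `|` B) i -> (0 <= a i)%E) ->
  (\esum_(i in A `|` B) a i <= \esum_(i in A) a i + \esum_(i in B) a i)%E.
Proof.
move=> a0; rewrite [leLHS]esum_mkcond [X in (_ <= X + _)%E]esum_mkcond.
rewrite [X in (_ <= _ + X)%E]esum_mkcond -esumD; last 2 first.
- by move=> i _; case: ifPn => // /set_mem h; apply: a0; left.
- by move=> i _; case: ifPn => // /set_mem h; apply: a0; right.
apply: le_esum => i _; rewrite in_setU.
case: (boolP (i \in A)) => iA; case: (boolP (i \in B)) => iB /=; rewrite ?adde0 ?add0e//.
by rewrite leeDl//; apply: a0; left; exact: set_mem.
Qed.

End esum_facts.

Section mass.
Context (R : realType) (d : measure_display) (X : measurableType d).
Context (T : set (X * X)) (mu : probability X R) (rho : X * X -> R).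
Hypothesis gT : is_graph T.
Hypothesis hrho : RN_cocycle (conn_rel T) mu rho.
Local Notation E := (conn_rel T).

Definition mass (x : X) (A : set X) : \bar R := \esum_(y in A) (rho (y, x))%:E.

Lemma rho_gt0 x y : E (x, y) -> 0 < rho (y, x).
Proof. by move=> xy; case: hrho => _ h _ _; apply: h; exact: conn_sym. Qed.

(** The cocycle identity, arranged as the change of the base point from [x] to [y]. *)
Lemma rho_trans x y z : E (x, y) -> E (x, z) -> rho (z, x) = rho (z, y) * rho (y, x).
Proof.
move=> xy xz; case: hrho => _ _ h _; rewrite h//.
exact: conn_trans (conn_sym gT xy) xz.
Qed.

Lemma rho_refl x : rho (x, x) = 1.
Proof.
have r0 := rho_gt0 (conn_refl T x).
have := rho_trans (conn_refl T x) (conn_refl T x).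
by rewrite -{1}[rho (x, x)]mulr1 => /(mulfI (lt0r_neq0 r0)).
Qed.

Lemma rho_inv x y : E (x, y) -> rho (x, y) = (rho (y, x))^-1.
Proof.
move=> xy; have := rho_trans xy (conn_refl T x); rewrite rho_refl.
move=> /esym/(canRL (mulfK _)) ->; first by rewrite mul1r.
by rewrite gt_eqF// rho_gt0.
Qed.

Lemma mass_base x w A : A `<=` eclass E x -> E (x, w) ->
  mass w A = (mass x A * (rho (x, w))%:E)%E.
Proof.
move=> AE xw; rewrite /mass -esumZr; last 2 first.
- by apply: rho_gt0; exact: conn_sym.
- by move=> y /AE /rho_gt0/ltW; rewrite lee_fin.
apply: eq_esum => y /AE xy; rewrite -EFinM -(rho_trans (conn_sym gT xw))//.
exact: conn_trans (conn_sym gT xw) xy.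
Qed.

Lemma mass_ge0 x A : A `<=` eclass E x -> (0 <= mass x A)%E.
Proof. by move=> AE; apply: esum_ge0 => y /AE /rho_gt0/ltW; rewrite lee_fin. Qed.

Lemma mass_fin_base x w A : A `<=` eclass E x -> E (x, w) ->
  (mass x A < +oo)%E -> (mass w A < +oo)%E.
Proof.
move=> AE xw; rewrite (mass_base AE xw) => h.
have := mass_ge0 AE; case: (mass x A) h => // r _ _; exact: ltry.
Qed.

Lemma mass_sub x A B : B `<=` eclass E x -> A `<=` B -> (mass x A <= mass x B)%E.
Proof. by move=> BE AB; apply: sub_esum => // y /BE /rho_gt0/ltW; rewrite lee_fin. Qed.

Lemma mass_U x A B : A `|` B `<=` eclass E x -> (mass x A < +oo)%E -> (mass x B < +oo)%E ->
  (mass x (A `|` B) < +oo)%E.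
Proof.
move=> AB fA fB; apply: le_lt_trans (esumU_le _) _; last exact: lte_add_pinfty.
by move=> y /AB /rho_gt0/ltW; rewrite lee_fin.
Qed.

End mass.

Section enumerated_mass.
Context (R : realType) (d : measure_display) (X : measurableType d).
Context (T : set (X * X)) (phi : nat -> X -> X) (N : set X).
Context (mu : probability X R) (rho : X * X -> R).
Hypothesis sX : standard_borel R X.
Hypothesis gT : is_graph T.
Hypothesis mphi : forall i, measurable_fun setT (phi i).
Hypothesis Ephi : forall i x, conn_rel T (x, phi i x).
Hypothesis phiE : forall x y, ~ N x -> conn_rel T (x, y) -> exists i, phi i x = y.
Hypothesis mN : measurable N.
Hypothesis hrho : RN_cocycle (conn_rel T) mu rho.

Lemma measurable_rho_phi i j : measurable_fun setT (fun x => rho (phi i x, phi j x)).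
Proof.
case: hrho => -[mE mrho] _ _ _.
rewrite (_ : (fun x => _) = (rho \_ (conn_rel T)) \o (fun x => (phi i x, phi j x))).
  apply: measurableT_comp; last exact: measurable_fun_pair.
  by apply/(measurable_restrict _ mE measurableT); rewrite setTI.
apply/funext => x /=; rewrite patchE ifT//; apply/mem_set.
exact: conn_trans (conn_sym gT (Ephi i x)) (Ephi j x).
Qed.

Lemma measurable_rho_base i : measurable_fun setT (fun x => rho (phi i x, x)).
Proof.
case: hrho => -[mE mrho] _ _ _.
rewrite (_ : (fun x => _) = (rho \_ (conn_rel T)) \o (fun x => (phi i x, x))).
  apply: measurableT_comp; last by apply: measurable_fun_pair => //; exact: measurable_id.
  by apply/(measurable_restrict _ mE measurableT); rewrite setTI.
apply/funext => x /=; rewrite patchE ifT//; apply/mem_set.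
exact: conn_sym.
Qed.

Lemma measurable_mass (A : X -> set X) : (forall x, A x `<=` eclass (conn_rel T) x) ->
  (forall l, measurable [set x | ~ N x /\ A x (phi l x)]) ->
  measurable_fun (~` N) (fun x => mass rho x (A x)).
Proof.
move=> AE mA; have mY : measurable (~` N) by exact: measurableC.
rewrite (_ : (fun x => _) = (fun x => \esum_(y in setT) (if y \in A x then (rho (y, x))%:E else 0%E))).
  apply: (measurable_enumerated_esum sX mphi phiE mN).
  - move=> x y; case: ifPn => // /set_mem Axy.
    by rewrite lee_fin ltW// (rho_gt0 gT hrho)//; exact: AE.
  - by move=> x y; case: ifPn => [/set_mem Axy _|_ []//]; exact: AE.
  - move=> l; apply: (measurable_fun_if mY).
    + apply: (measurable_fun_bool true) => //.
      rewrite (_ : _ `&` _ = [set x | ~ N x /\ A x (phi l x)]) //.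
      by apply/seteqP; split=> x [nx h]; split => //; [exact: set_mem|exact/mem_set].
    + by apply: measurable_funTS; apply/measurable_EFinP; exact: measurable_rho_base.
    + exact: measurable_cst.
by apply/funext => x; rewrite /mass esum_mkcond.
Qed.

End enumerated_mass.

(** * Sides of finite mass *)
Section side_mass.
Context (R : realType) (d : measure_display) (X : measurableType d).
Context (T : set (X * X)) (phi : nat -> X -> X) (N : set X).
Context (mu nu : probability X R) (rhom rhon : X * X -> R).
Hypothesis sX : standard_borel R X.
Hypotheses (gT : is_graph T) (aT : acyclic T) (mT : measurable T).
Hypothesis mphi : forall i, measurable_fun setT (phi i).
Hypothesis Ephi : forall i x, conn_rel T (x, phi i x).
Hypothesis phiE : forall x y, ~ N x -> conn_rel T (x, y) -> exists i, phi i x = y.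
Hypothesis mN : measurable N.
Hypothesis NN : saturation (conn_rel T) N = N.
Hypothesis hm : RN_cocycle (conn_rel T) mu rhom.
Hypothesis hn : RN_cocycle (conn_rel T) nu rhon.
Hypothesis numu : nu `<< mu.
Local Notation E := (conn_rel T).

Lemma measurable_lty (F : X -> \bar R) : measurable_fun (~` N) F ->
  measurable [set x | ~ N x /\ (F x < +oo)%E].
Proof.
move=> mF; rewrite (_ : [set x | _] = (~` N) `&` F @^-1` [set` `]-oo, (+oo%E : \bar R)[]).
  apply: mF; [exact: measurableC|exact: emeasurable_itv].
by apply/seteqP; split=> x [nx]; rewrite /= in_itv.
Qed.

Lemma measurable_class_mass : measurable_fun (~` N) (fun x => mass rhom x (eclass E x)).
Proof.
apply: (measurable_mass sX gT mphi Ephi phiE mN hm) => [x y //|l].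
rewrite (_ : [set x | _] = ~` N); first exact: measurableC.
by apply/seteqP; split=> x /=; [case|move=> nx; split => //; exact: Ephi].
Qed.

(** Giving each point [y] of a class of finite mass the weight [w y], its share of the
    total, makes the weights of the class sum to one. So the transport of [w y] to
    all points of the class has finite integral, which for [nu] is the integral
    of [w] times the total [rho_nu]-mass. *)
Lemma class_mass_finite :
  nu.-negligible [set x | [/\ ~ N x, (mass rhom x (eclass E x) < +oo)%E &
     ~ (mass rhon x (eclass E x) < +oo)%E]].
Proof.
have mE : measurable E by case: hm => -[].
have mY : measurable (~` N) by exact: measurableC.
pose S x := mass rhom x (eclass E x).
pose V := [set x | ~ N x /\ (S x < +oo)%E].
have mV : measurable V by exact: measurable_lty measurable_class_mass.
have S1 x : (1 <= S x)%E.
  rewrite /S -(rho_refl gT hm x) -(@esum_set1 R _ x (fun y => (rhom (y, x))%:E)).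
    apply: (mass_sub gT hm) => // y ->; exact: conn_refl.
  by rewrite (rho_refl gT hm).
pose w := (fun x => ((fine (S x))^-1)%:E) \_ V.
have w0 x : (0 <= w x)%E.
  rewrite /w patchE; case: ifPn => // _; rewrite lee_fin invr_ge0 fine_ge0//.
  by apply: le_trans (S1 x).
have mw : measurable_fun setT w.
  apply/(measurable_restrict _ mV measurableT); rewrite setTI.
  apply/measurable_EFinP.
  rewrite (_ : (fun x => (fine (S x))^-1) = (fun x => fine (S x) `^ (-1))); last first.
    by apply/funext => x; rewrite powR_inv1// fine_ge0// (le_trans _ (S1 x)).
  apply: (@measurableT_comp _ _ _ _ _ _ (fun r : R => r `^ (-1))); first exact: measurable_powR.
  apply: measurableT_comp => //; apply: (measurable_funS mY) measurable_class_mass.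
  by move=> x [].
pose h := (w \o snd) \_ E : X * X -> \bar R.
have mh : measurable_fun setT h.
  apply/(measurable_restrict _ mE measurableT); rewrite setTI.
  by apply: measurable_funTS; apply: measurableT_comp => //; exact: measurable_snd.
have h0 p : (0 <= h p)%E by rewrite /h patchE; case: ifP => // _; exact: w0.
have hE p : h p <> 0%E -> E p.
  by rewrite /h patchE; case: ifPn => [/set_mem//|_ []].
have hN x y : h (x, y) <> 0%E -> ~ N x /\ V y.
  rewrite /h patchE; case: ifPn => [/set_mem xy|_ []//]; rewrite /= /w patchE.
  case: ifPn => [/set_mem Vy _|_ []//]; split => //.
  by case: Vy => ny _; apply: outside_class (conn_sym gT xy) ny.
have tr := mass_transport mE hn mh h0 hE (@conn_sym _ T gT).
have fin : nu.-negligible [set x | ~ ((\esum_(y in setT) (h (y, x) * (rhon (y, x))%:E)) < +oo)%E].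
  apply: ae_lty.
  - apply: (measurable_class_esum sX mphi phiE mN
       (h := fun p => (h (p.2, p.1) * (rhon (p.2, p.1))%:E)%E)).
    + exact: (measurable_swapped mE hn mh hE).
    + move=> [x y] /=; have [->|/eqP/hE yx] := eqVneq (h (y, x)) 0%E; first by rewrite mul0e.
      by apply: mule_ge0 => //; rewrite lee_fin ltW// (rho_gt0 gT hn)//; exact: conn_sym.
    + move=> [x y] /=; have [->|/eqP hyx _] := eqVneq (h (y, x)) 0%E; first by rewrite mul0e.
      split; first by apply: (conn_sym gT); exact: hE.
      by have [_ []] := hN _ _ hyx.
  - move=> x; apply: esum_ge0 => y _.
    have [->|/eqP/hE yx] := eqVneq (h (y, x)) 0%E; first by rewrite mul0e.
    by apply: mule_ge0 => //; rewrite lee_fin ltW// (rho_gt0 gT hn)//; exact: conn_sym.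
  - rewrite -tr; apply: (@le_lt_trans _ _ (\int[nu]_(x in setT) (cst 1%E x))%E).
      apply: ge0_le_integral => //.
      - by move=> x _; exact: esum_ge0.
      - apply: (measurable_class_esum sX mphi phiE mN mh h0) => -[x y] hxy.
        by split; [exact: hE|case: (hN _ _ hxy)].
      - move=> x _ /=; have [Vx|nV] := pselect (V x); last first.
          rewrite esum1// => y _; apply: contrapT => hxy.
          have [nx [ny Sy]] := hN _ _ hxy; apply: nV; split => //.
          have xy := hE _ hxy.
          have := mass_fin_base gT hm (@subset_refl _ _) (conn_sym gT xy) Sy.
          by rewrite /S (eclass_eq gT xy).
        have xE y : E (x, y) -> V y.
          move=> xy; case: Vx => nx Sx; split; first exact: outside_class xy nx.
          have := mass_fin_base gT hm (@subset_refl _ _) xy Sx.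
          by rewrite /S (eclass_eq gT xy).
        have Sfin : S x = (fine (S x))%:E.
          by rewrite fineK// ge0_fin_numE ?(le_trans _ (S1 x))//; case: Vx.
        have Sgt0 : 0 < fine (S x).
          by rewrite -lte_fin -Sfin (lt_le_trans _ (S1 x)).
        have -> : \esum_(y in setT) h (x, y) =
            \esum_(y in eclass E x) ((rhom (y, x))%:E * ((fine (S x))^-1)%:E)%E.
          rewrite [RHS]esum_mkcond; apply: eq_esum => y _; rewrite /h patchE /=.
          have -> : ((x, y) \in E) = (y \in eclass E x).
            by apply/idP/idP => /set_mem ?; exact/mem_set.
          case: ifPn => // /set_mem xy; rewrite /w patchE ifT; last exact/mem_set/xE.
          have := mass_base gT hm (@subset_refl _ (eclass E x)) xy.
          rewrite {1}(eclass_eq gT xy) -/(S x) -/(S y) Sfin -EFinM => -> /=.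
          rewrite -EFinM; congr (_%:E); rewrite invfM mulrC; congr (_ * _).
          by rewrite -(rho_inv gT hm (conn_sym gT xy)).
        rewrite esumZr; last 2 first.
        - by rewrite invr_gt0.
        - by move=> y /(rho_gt0 gT hm)/ltW; rewrite lee_fin.
        by rewrite -/(mass rhom x (eclass E x)) -/(S x) Sfin -EFinM mulfV// gt_eqF.
    by rewrite integral_cst// -[X in (_ * X)%E]/(nu setT) probability_setT mule1 ltry.
apply: negligibleS fin => x [nx Sx nS]; apply: contra_not nS => fx.
have Vx : V x by [].
have Sfin : S x = (fine (S x))%:E.
  by rewrite fineK// ge0_fin_numE ?(le_trans _ (S1 x)).
have Sgt0 : 0 < fine (S x) by rewrite -lte_fin -Sfin (lt_le_trans _ (S1 x)).
move: fx; have -> : \esum_(y in setT) (h (y, x) * (rhon (y, x))%:E)%E =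
   \esum_(y in eclass E x) ((rhon (y, x))%:E * ((fine (S x))^-1)%:E)%E.
  rewrite [RHS]esum_mkcond; apply: eq_esum => y _; rewrite /h patchE /=.
  have -> : ((y, x) \in E) = (y \in eclass E x).
    by apply/idP/idP => /set_mem ?; apply/mem_set; exact: (conn_sym gT).
  case: ifPn => [_|_]; last by rewrite mul0e.
  by rewrite /w patchE ifT; [exact: muleC|exact: (mem_set Vx)].
rewrite esumZr; last 2 first.
- by rewrite invr_gt0.
- by move=> y /(rho_gt0 gT hn)/ltW; rewrite lee_fin.
rewrite -/(mass rhon x (eclass E x)).
have := mass_ge0 gT hn (@subset_refl _ (eclass E x)).
case: mass => [r _ _| |//]; first exact: ltry.
by rewrite gt0_mulye// lte_fin invr_gt0.
Qed.

(** Excluding the classes of finite mass makes the light edges a flow. *)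
Definition light x y := [/\ ~ N x, T (x, y), (mass rhom x (side T x y) < +oo)%E &
  ~ (mass rhom x (eclass E x) < +oo)%E].

Lemma side_mass_finite : nu.-negligible
  [set x | exists y, [/\ ~ N x, T (x, y), (mass rhom x (side T x y) < +oo)%E &
     ~ (mass rhon x (side T x y) < +oo)%E]].
Proof.
have mE : measurable E by case: hm => -[].
have mD i : measurable [set x | light x (phi i x)].
  have mside : measurable_fun (~` N) (fun x => mass rhom x (side T x (phi i x))).
    apply: (measurable_mass sX gT mphi Ephi phiE mN hm) => //.
      by move=> x; exact: side_conn.
    by move=> l; exact: (measurable_side sX mT mphi phiE mN).
  rewrite (_ : [set x | _] = [set x | T (x, phi i x)] `&`
     ([set x | ~ N x /\ (mass rhom x (side T x (phi i x)) < +oo)%E] `\`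
      [set x | ~ N x /\ (mass rhom x (eclass E x) < +oo)%E])).
    apply: measurableI; first by apply: measurable_comp_pair => //; exact: measurable_id.
    by apply: measurableD; apply: measurable_lty => //; exact: measurable_class_mass.
  apply/seteqP; split=> x.
    by case=> nx Tx sx cx; do 2!split => //; case.
  by case=> /= Tx [[nx sx] cx]; split => // cf; apply: cx.
have DN x y : light x y -> ~ N x by case.
have DT x y : light x y -> T (x, y) by case.
have union x A B : eclass E x = A `|` B -> (mass rhom x A < +oo)%E -> (mass rhom x B < +oo)%E ->
    ~ (mass rhom x (eclass E x) < +oo)%E -> False.
  by move=> AB fA fB; apply; rewrite AB; apply: (mass_U gT hm) => //; rewrite AB.
have Duniq x y y' : light x y -> light x y' -> y = y'.
  case=> nx Txy fxy cx [_ Txy' fxy' _]; apply: contrapT => yy'.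
  exact: union (conn_two_sides gT aT Txy Txy' yy') fxy fxy' cx.
have Dasym x y : light x y -> ~ light y x.
  case=> nx Txy fxy cx [_ Tyx fyx _].
  apply: (union _ _ _ (conn_side Txy) fxy _ cx).
  apply: (mass_fin_base gT hm (@side_conn _ T y x) _ fyx).
  exact: conn_step (conn_refl T y) Tyx.
have Dback x y z : light x y -> T (z, x) -> z <> y -> light z x.
  case=> nx Txy fxy cx Tzx zy.
  have xz : E (x, z) by apply: conn_step (conn_refl T x) _; exact: graph_sym.
  split => //.
  - exact: outside_class xz nx.
  - apply: le_lt_trans (mass_fin_base gT hm (@side_conn _ T x y) xz fxy).
    apply: (mass_sub gT hm); last exact: side_sub.
    by move=> u /side_conn; apply: conn_trans; exact: conn_sym.
  - move=> h; apply: cx; rewrite (eclass_eq gT xz).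
    exact: (mass_fin_base gT hm (@subset_refl _ _) (conn_sym gT xz) h).
have [g [mg gD gN mV]] := flow_map mphi phiE mD DN DT Duniq.
have Z1 := upsum_finite sX gT aT mE mphi phiE mN NN DN DT Dasym Dback mg gD gN mV numu hm hn.
have upE rho x : light x (g x) -> upsum light g rho x = mass rho x (side T x (g x)).
  by move=> Dx; rewrite /upsum (upstream_side gT aT DT Dasym Dback gD gN Dx).
apply: (@negligibleS _ _ _ _ ([set x | light x (g x) /\ ~ (upsum light g rhon x < +oo)%E] `|`
   [set x | [/\ ~ N x, (mass rhom x (eclass E x) < +oo)%E & ~ (mass rhon x (eclass E x) < +oo)%E]])).
  move=> x [y [nx Txy fm fn]].
  have [cf|ci] := pselect (mass rhom x (eclass E x) < +oo)%E.
    right; split => // cn; apply: fn; apply: le_lt_trans cn.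
    by apply: (mass_sub gT hn) => //; exact: side_conn.
  have Dxy : light x y by [].
  by left; rewrite /= upE (gD _ _ Dxy).
apply: negligibleU; last exact: class_mass_finite.
by apply: Z1 => x Dx; rewrite upE//; case: Dx.
Qed.

End side_mass.

(** * Change of cocycle under a change of measure *)
Section density.
Context (R : realType) (d : measure_display) (X : measurableType d).
Variables (mu nu : probability X R).

Lemma density : nu `<< mu -> mu `<< nu -> exists F : X -> R,
  [/\ measurable_fun setT F, forall x, 0 <= F x, mu.-integrable setT (EFin \o F),
      forall G : X -> \bar R, (forall x, (0 <= G x)%E) -> measurable_fun setT G ->
        (\int[nu]_x G x = \int[mu]_x (G x * (F x)%:E))%E &
      mu.-negligible [set x | F x = 0]].
Proof.
move=> numu munu; pose f := Radon_Nikodym_SigmaFinite.f nu mu.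
have fF x : f x = (fine (f x))%:E by rewrite fineK// Radon_Nikodym_SigmaFinite.f_fin_num.
have intf : mu.-integrable setT f by exact: Radon_Nikodym_SigmaFinite.f_integrable.
have mf : measurable_fun setT f by exact: measurable_int intf.
have mF : measurable_fun setT (fine \o f) by exact: measurableT_comp.
exists (fine \o f); split => //.
- by move=> x; rewrite fine_ge0// Radon_Nikodym_SigmaFinite.f_ge0.
- by rewrite (_ : EFin \o _ = f) //; apply/funext => x /=; rewrite -fF.
- move=> G G0 mG; rewrite -(Radon_Nikodym_SigmaFinite.change_of_variables numu)//.
  by apply: eq_integral => x _; rewrite -fF.
- apply: (dominates_negligible munu).
  have mZ : measurable [set x | (fine \o f) x = 0].
    by rewrite -[X in measurable X]setTI; exact: (mF measurableT [set 0] (measurable_set1 0)).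
  apply/negligibleP => //.
  transitivity (\int[mu]_(x in [set x | (fine \o f) x = 0%R]) f x)%E.
    exact: (Radon_Nikodym_SigmaFinite.f_integral numu mZ).
  rewrite (eq_integral (fun=> 0%E)) ?integral0// => x /set_mem /= fx0.
  by rewrite fF fx0.
Qed.

End density.

Section cocycle_change.
Context (R : realType) (d : measure_display) (X : measurableType d).
Context (T : set (X * X)) (phi : nat -> X -> X) (N : set X).
Context (mu nu : probability X R) (rhom rhon : X * X -> R) (F : X -> R).
Hypothesis sX : standard_borel R X.
Hypothesis gT : is_graph T.
Hypothesis mphi : forall i, measurable_fun setT (phi i).
Hypothesis Ephi : forall i x, conn_rel T (x, phi i x).
Hypothesis phiE : forall x y, ~ N x -> conn_rel T (x, y) -> exists i, phi i x = y.
Hypothesis mN : measurable N.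
Hypothesis NN : saturation (conn_rel T) N = N.
Hypothesis hm : RN_cocycle (conn_rel T) mu rhom.
Hypothesis hn : RN_cocycle (conn_rel T) nu rhon.
Hypothesis mF : measurable_fun setT F.
Hypothesis F0 : forall x, 0 <= F x.
Hypothesis Fnu : forall G : X -> \bar R, (forall x, (0 <= G x)%E) -> measurable_fun setT G ->
  (\int[nu]_x G x = \int[mu]_x (G x * (F x)%:E))%E.
Local Notation E := (conn_rel T).

(** Both sides are the integral over [nu] of the number of points of [A] that
    [phi i] sends to the current point, computed with [rhon] and with [rhom]. *)
Lemma cocycle_change_set i A : measurable A -> A `<=` ~` N ->
  (\int[mu]_(x in A) (rhon (phi i x, x) * F x)%:E =
   \int[mu]_(x in A) (F (phi i x) * rhom (phi i x, x))%:E)%E.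
Proof.
move=> mA AN.
have mE : measurable E by case: hm => -[].
pose W := [set p : X * X | A p.2 /\ p.1 = phi i p.2].
have mW : measurable W.
  rewrite (_ : W = snd @^-1` A `&` [set p | p.1 = (phi i \o snd) p]) //.
  apply: measurableI; first by rewrite -[X in measurable X]setTI; exact: measurable_snd.
  apply: (measurable_eq_fun sX); first exact: measurable_fst.
  by apply: measurableT_comp => //; exact: measurable_snd.
pose h : X * X -> \bar R := (cst 1%E) \_ W.
have mh : measurable_fun setT h.
  by apply/(measurable_restrict _ mW measurableT); exact: measurable_cst.
have h0 p : (0 <= h p)%E by rewrite /h patchE; case: ifP.
have WE x y : W (x, y) -> E (x, y) by case=> /= _ ->; exact: conn_sym.
have hE p : h p <> 0%E -> E p.
  by case: p => x y; rewrite /h patchE; case: ifPn => [/set_mem/WE//|_ []].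
have hN p : h p <> 0%E -> E p /\ ~ N p.1.
  move=> hp; split; first exact: hE.
  move: hp; case: p => x y; rewrite /h patchE; case: ifPn => [/set_mem Wxy _|_ []//].
  by apply: (outside_class gT NN (conn_sym gT (WE _ _ Wxy))); apply: AN; case: Wxy.
have single (w : X * X -> \bar R) x : (forall y, E (x, y) -> (0 <= w (y, x))%E) ->
    \esum_(y in setT) (h (y, x) * w (y, x))%E = ((fun x => w (phi i x, x)) \_ A) x.
  move=> w0; rewrite [RHS]patchE; case: ifPn => [/set_mem Ax|/negP nA].
    rewrite -(@esum_set1 R _ (phi i x) (fun y => w (y, x))); last exact: w0.
    rewrite [RHS]esum_mkcond; apply: eq_esum => y _; rewrite /h patchE.
    have -> : ((y, x) \in W) = (y \in [set phi i x]).
      by apply/idP/idP => /set_mem h'; apply/mem_set; [case: h'|split].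
    by case: ifP; rewrite ?mul1e ?mul0e.
  apply: esum1 => y _; rewrite /h patchE; case: ifPn => [/set_mem[/= Ax _]|_]; last by rewrite mul0e.
  by case: nA; exact/mem_set.
have Es := @conn_sym _ T gT.
pose K x := \esum_(y in setT) h (x, y).
have mK : measurable_fun setT K by exact: (measurable_class_esum sX mphi phiE mN mh h0 hN).
have K0 x : (0 <= K x)%E by exact: esum_ge0.
have sgl rho (la : probability X R) x : RN_cocycle E la rho ->
    \esum_(y in setT) (h (y, x) * (rho (y, x))%:E)%E = ((fun x => (rho (phi i x, x))%:E) \_ A) x.
  move=> hr; apply: (single (fun p => (rho p)%:E)) => y xy.
  by rewrite lee_fin ltW// (rho_gt0 gT hr).
have trn := mass_transport mE hn mh h0 hE Es.
transitivity (\int[nu]_x K x)%E.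
  rewrite trn Fnu; last 2 first.
  - move=> x; rewrite (sgl _ _ _ hn) patchE; case: ifP => // _.
    by rewrite lee_fin ltW// (rho_gt0 gT hn).
  - rewrite (_ : (fun x => _) = (fun x => (rhon (phi i x, x))%:E) \_ A); last first.
      by apply/funext => x; exact: sgl hn.
    apply/(measurable_restrict _ mA measurableT); apply: measurable_funTS.
    by apply/measurable_EFinP; exact: (measurable_rho_base gT mphi Ephi hn).
  rewrite integral_mkcond; apply: eq_integral => x _.
  rewrite (sgl _ _ _ hn) !patchE; case: ifP => _; last by rewrite mul0e.
  by rewrite EFinM.
rewrite Fnu//.
pose h' p := (h p * (F p.1)%:E)%E.
have h'0 p : (0 <= h' p)%E by apply: mule_ge0 => //; rewrite lee_fin.
have mh' : measurable_fun setT h'.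
  apply: emeasurable_funM => //; apply/measurable_EFinP.
  by apply: measurableT_comp => //; exact: measurable_fst.
have h'E p : h' p <> 0%E -> E p.
  by move=> hp; apply: hE => h00; apply: hp; rewrite /h' h00 mul0e.
transitivity (\int[mu]_x \esum_(y in setT) h' (x, y))%E.
  apply: eq_integral => x _; rewrite /K /h' /=.
  have [Fx0|Fx] := eqVneq (F x) 0.
    by rewrite Fx0 mule0 esum1// => y _; rewrite mule0.
  by rewrite esumZr// lt_neqAle eq_sym Fx F0.
rewrite (mass_transport mE hm mh' h'0 h'E Es) [RHS]integral_mkcond.
apply: eq_integral => x _.
transitivity (\esum_(y in setT) (h (y, x) * (fun p => (F p.1 * rhom p)%:E) (y, x))%E).
  by apply: eq_esum => y _; rewrite /h' /= -muleA -EFinM.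
rewrite (single (fun p => (F p.1 * rhom p)%:E)) // => y xy.
by rewrite lee_fin mulr_ge0// ltW// (rho_gt0 gT hm).
Qed.

(** The functions need not be integrable, so they are compared where one of them
    is bounded by [k]. *)
Lemma cocycle_change : mu.-negligible [set x | ~ N x /\
   exists y, E (x, y) /\ rhon (y, x) * F x <> F y * rhom (y, x)].
Proof.
have mY : measurable (~` N) by exact: measurableC.
pose a i x := rhon (phi i x, x) * F x.
pose b i x := F (phi i x) * rhom (phi i x, x).
have ma i : measurable_fun setT (a i).
  by apply: measurable_funM => //; exact: (measurable_rho_base gT mphi Ephi hn).
have mb i : measurable_fun setT (b i).
  apply: measurable_funM; last exact: (measurable_rho_base gT mphi Ephi hm).
  exact: measurableT_comp.
have a0 i x : 0 <= a i x by rewrite mulr_ge0// ltW// (rho_gt0 gT hn).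
have b0 i x : 0 <= b i x by rewrite mulr_ge0// ltW// (rho_gt0 gT hm).
pose Dk i k := ~` N `&` ((a i) @^-1` `]-oo, k%:R] ).
have mD i k : measurable (Dk i k).
  apply: measurableI => //; rewrite -[X in measurable X]setTI.
  by apply: ma => //; exact: measurable_itv.
have ae i k : mu.-negligible [set x | Dk i k x /\ a i x <> b i x].
  have : ae_eq mu (Dk i k) (EFin \o a i) (EFin \o b i).
    apply: integral_ae_eq => //.
    - apply/integrableP; split.
        by apply: measurable_funTS; exact/measurable_EFinP.
      apply: (@le_lt_trans _ _ (\int[mu]_(x in setT) (cst k%:R%:E x))%E).
        rewrite integral_mkcond; apply: ge0_le_integral => //.
        + by move=> x _; rewrite patchE; case: ifP.
        + apply/(measurable_restrict _ (mD i k) measurableT); apply: measurable_funTS.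
          by apply: measurableT_comp => //; exact/measurable_EFinP.
        + move=> x _ /=; rewrite patchE; case: ifPn => [/set_mem[_ /=]|_]; last by rewrite lee_fin.
          by rewrite in_itv /= lee_fin ger0_norm.
      by rewrite integral_cst// -[X in (_ * X)%E]/(mu setT) probability_setT mule1 ltry.
    - by apply: measurable_funTS; exact/measurable_EFinP.
    - move=> A AD mA; apply: cocycle_change_set => // x /AD[] //.
  by apply: negligibleS => x /= [Dx ne] /(_ Dx) [].
apply: negligibleS (negligible_bigcup (fun i => negligible_bigcup (ae i))) => x [nx [y [xy ne]]].
have [i iy] := phiE nx xy; exists i => //; exists (Num.bound (a i x)) => //.
split; last by rewrite /a /b iy.
by split => //=; rewrite in_itv /=; apply: ltW; exact: archi_boundP.
Qed.

End cocycle_change.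

(** * Suprema over sides *)
Lemma esum_infinite (R : realType) (X : choiceType) (A : set X) (c : R) :
  0 < c -> infinite_set A -> \esum_(i in A) c%:E = +oo%E.
Proof.
move=> c0 iA; apply/eqyP => M M0.
have [f [fA fi]] : exists f : nat -> X, (forall n, A (f n)) /\ injective f.
  have /infiniteP/card_leP[h] := iA.
  pose e n : [set: nat] := SigSub (mem_set (I : [set: nat] n)).
  exists (fun n => val (h (e n))); split; first by move=> n; exact: set_valP.
  move=> i j /val_inj/('inj_h) ij.
  by have := ij (mem_set I) (mem_set I) => /(congr1 val).
apply: le_trans _ (@sub_esum _ _ (range f) A (fun=> c%:E) _ _); last 2 first.
- by move=> _ [n _ <-].
- by move=> x _; rewrite lee_fin ltW.
rewrite esum_image; last by move=> i j _ _; exact: fi.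
rewrite -nneseries_esumT; last by move=> n; rewrite lee_fin ltW.
pose n := Num.bound (M / c).
apply: le_trans _ (@nneseries_lim_ge _ _ xpredT 0 n _); last by move=> i _ _; rewrite lee_fin ltW.
rewrite sumEFin lee_fin sumr_const_nat subn0 -mulr_natl -ler_pdivrMr//.
by apply: ltW; apply: archi_boundP; rewrite divr_ge0// ltW.
Qed.

Section drop.
Context (R : realType) (d : measure_display) (X : measurableType d).
Context (T : set (X * X)) (phi : nat -> X -> X) (N : set X).
Context (mu : probability X R) (rho : X * X -> R) (F : X -> R).
Hypothesis sX : standard_borel R X.
Hypotheses (gT : is_graph T) (aT : acyclic T) (mT : measurable T).
Hypothesis mphi : forall i, measurable_fun setT (phi i).
Hypothesis Ephi : forall i x, conn_rel T (x, phi i x).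
Hypothesis phiE : forall x y, ~ N x -> conn_rel T (x, y) -> exists i, phi i x = y.
Hypothesis mN : measurable N.
Hypothesis NN : saturation (conn_rel T) N = N.
Hypothesis hrho : RN_cocycle (conn_rel T) mu rho.
Local Notation E := (conn_rel T).

(** The supremum of [rho] over [A] is smaller than over the class: the bound
    refers to the value at some point [w] of the class and thus does not depend on
    a base point, and the gap [m.+1%:R^-1] keeps the condition countable. *)
Definition below x (A : set X) := exists w (m : nat), E (x, w) /\
  forall z, A z -> rho (z, w) <= 1 - m.+1%:R^-1.

Lemma oneB_natinv_lt1 (m : nat) : 1 - m.+1%:R^-1 < 1 :> R.
Proof. by rewrite ltrBlDr ltrDl invr_gt0. Qed.

(** The larger of the two points to which [A] and [B] are compared cannot belong to
    either of them. *)
Lemma below_union x A B : eclass E x = A `|` B -> below x A -> below x B -> False.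
Proof.
move=> AB [w [m [xw hA]]] [w' [m' [xw' hB]]].
have ww' : E (w, w') by apply: conn_trans (conn_sym gT xw) xw'.
have [w1|w1] := leP 1 (rho (w', w)).
  have : (A `|` B) w' by rewrite -AB.
  case=> [/hA|/hB]; last by rewrite (rho_refl gT hrho) leNgt oneB_natinv_lt1.
  by move=> /(le_trans w1); rewrite leNgt oneB_natinv_lt1.
have : (A `|` B) w by rewrite -AB.
case=> [/hA|/hB]; first by rewrite (rho_refl gT hrho) leNgt oneB_natinv_lt1.
rewrite (rho_inv gT hrho ww') => h.
have r0 := rho_gt0 gT hrho ww'.
have : 1 < (rho (w', w))^-1 by rewrite invf_gt1.
by move=> /lt_le_trans/(_ h); rewrite ltNge ltW// oneB_natinv_lt1.
Qed.

Lemma below_base x y A : E (x, y) -> below x A -> below y A.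
Proof.
move=> xy [w [m [xw h]]]; exists w, m; split => //.
exact: conn_trans (conn_sym gT xy) xw.
Qed.

(** The supremum over [side x y] is smaller than over [side y t], in the same
    countable form. *)
Definition falls x y t := exists u (m : nat), side T y t u /\
  forall z, side T x y z -> rho (z, u) <= 1 - m.+1%:R^-1.

Definition sink x y := [/\ ~ N x, T (x, y) & below x (side T x y)].

Lemma sink_null x y : sink x y -> ~ N x. Proof. by case. Qed.
Lemma sink_edge x y : sink x y -> T (x, y). Proof. by case. Qed.

Lemma sink_uniq x y y' : sink x y -> sink x y' -> y = y'.
Proof.
case=> nx Txy bxy [_ Txy' bxy']; apply: contrapT => yy'.
exact: (below_union (conn_two_sides gT aT Txy Txy' yy') bxy bxy').
Qed.

Lemma sink_asym x y : sink x y -> ~ sink y x.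
Proof.
case=> nx Txy bxy [_ Tyx byx]; apply: (below_union (conn_side Txy) bxy).
apply: below_base byx; exact: conn_step (conn_refl T y) Tyx.
Qed.

Lemma sink_back x y w : sink x y -> T (w, x) -> w <> y -> sink w x.
Proof.
case=> nx Txy bxy Twx wy.
have xw : E (x, w) by apply: conn_step (conn_refl T x) _; exact: graph_sym.
split => //; first exact: (outside_class gT NN xw nx).
have [v [m [wv h]]] := below_base xw bxy.
by exists v, m; split => // z wz; apply: h; exact: side_sub Txy Twx wy _ wz.
Qed.

Lemma measurable_sink i : measurable [set x | sink x (phi i x)].
Proof.
have mY : measurable (~` N) by exact: measurableC.
rewrite (_ : [set x | _] = ~` N `&` ([set x | T (x, phi i x)] `&` \bigcup_j \bigcup_m \bigcap_l
   (~` [set x | ~ N x /\ side T x (phi i x) (phi l x)] `|`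
    [set x | rho (phi l x, phi j x) <= 1 - m.+1%:R^-1]))).
  apply: measurableI => //; apply: measurableI.
    by apply: measurable_comp_pair => //; exact: measurable_id.
  apply: bigcupT_measurable => j; apply: bigcupT_measurable => m.
  apply: bigcap_measurableType => l _; apply: measurableU.
    by apply: measurableC; exact: (measurable_side sX mT mphi phiE mN).
  rewrite (_ : [set x | _] = (fun x => rho (phi l x, phi j x)) @^-1` `]-oo, 1 - m.+1%:R^-1]).
    rewrite -[X in measurable X]setTI.
    by apply: (measurable_rho_phi gT mphi Ephi hrho) => //; exact: measurable_itv.
  by apply/seteqP; split=> x; rewrite /= in_itv.
apply/seteqP; split=> x.
  case=> nx Tx [w [m [xw h]]]; split => //; split => //.
  have [j jw] := phiE nx xw; exists j => //; exists m => // l _.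
  have [sl|nl] := pselect (side T x (phi i x) (phi l x)); last by left => -[].
  by right; rewrite /= jw; exact: h.
case=> nx [Tx [j _ [m _ h]]]; split => //; exists (phi j x), m; split => // z sz.
have [l lz] := phiE nx (side_conn sz).
by case: (h l I) => /=; rewrite lz // => h'; case: h'.
Qed.

Variable g : X -> X.
Hypothesis mg : measurable_fun setT g.
Hypothesis gD : forall x y, sink x y -> g x = y.
Hypothesis gN : forall x, ~ sink x (g x) -> g x = x.
Hypothesis mV : measurable [set x | sink x (g x)].

Let up := upstream sink g.
Let V := [set x | sink x (g x)].
Let mE : measurable E. Proof. by case: hrho => -[]. Qed.

Let upE x z : up (x, z) -> E (x, z).
Proof. exact: (upstream_conn gT aT sink_edge sink_asym sink_back gD gN). Qed.

Let q (l : nat) x := if `[< up (x, phi l x) >] then rho (phi l x, x) else 0.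

(** The supremum of [rho^x] over the points behind [x]. The value 0 that [q] takes
    at other indices is harmless, since [rho^x x = 1]. *)
Definition peak x := sups (q^~ x) 0.

Lemma peak_bounded x : V x -> has_ubound (range (q^~ x)).
Proof.
move=> Vx; have [nx Tx [w [m [xw h]]]] := Vx.
exists (rho (w, x)) => _ [l _ <-]; rewrite /q; case: asboolP => [ul|_]; last first.
  by rewrite ltW// (rho_gt0 gT hrho).
have sl : side T x (g x) (phi l x).
  by rewrite -(upstream_side gT aT sink_edge sink_asym sink_back gD gN Vx).
rewrite (rho_trans gT hrho xw (upE ul)) ler_piMl ?(ltW (rho_gt0 gT hrho xw))//.
by apply: le_trans (h _ sl) _; rewrite ltW// oneB_natinv_lt1.
Qed.

Lemma peak_ub x z : up (x, z) -> rho (z, x) <= peak x.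
Proof.
move=> uxz; have Vx : V x by case: uxz.
have [nx _ _] := Vx; have [l lz] := phiE nx (upE uxz).
apply: sup_upper_bound.
  split; first by exists (q 0%N x), 0%N.
  have [M hM] := peak_bounded Vx; exists M => _ [k _ <-]; exact: (hM _ (ex_intro2 _ _ k I erefl)).
by exists l => //; rewrite /q lz; case: asboolP.
Qed.

Lemma peak_le x c : 0 <= c -> (forall z, up (x, z) -> rho (z, x) <= c) -> peak x <= c.
Proof.
move=> c0 h; apply: ge_sup; first by exists (q 0%N x), 0%N.
by move=> _ [l _ <-]; rewrite /q; case: asboolP => // /h.
Qed.

Lemma peak_gt0 x : V x -> 0 < peak x.
Proof.
move=> Vx; apply: lt_le_trans (peak_ub (upstream_refl Vx)).
by rewrite (rho_refl gT hrho).
Qed.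

Lemma measurable_peak : measurable_fun V peak.
Proof.
apply: measurable_fun_sups; first exact: peak_bounded.
move=> l; apply: measurable_funTS; apply: measurable_fun_ifT.
- apply: (measurable_fun_bool true); rewrite setTI.
  rewrite (_ : _ @^-1` _ = [set x | up (x, phi l x)]).
    apply: (measurable_comp_pair (A := up) (f := id) (g := phi l)) => //.
    exact: (measurable_upstream sX mg mV).
  by apply/seteqP; split=> x /asboolP.
- exact: (measurable_rho_base gT mphi Ephi hrho).
- exact: measurable_cst.
Qed.

Let V2 := V `&` g @^-1` V.

Let mV2 : measurable V2.
Proof. by apply: measurableI => //; rewrite -[X in measurable X]setTI; exact: mg. Qed.

Let rE : X * X -> R := rho \_ E.

Let mrE : measurable_fun setT rE.
Proof.
case: hrho => -[_ mr] _ _ _.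
by apply/(measurable_restrict _ mE measurableT); rewrite setTI.
Qed.

Let rEE p : E p -> rE p = rho p.
Proof. by move=> Ep; rewrite /rE patchE ifT//; exact/mem_set. Qed.

(** The increment of the supremum from [x] to [g x], as seen from [x]. *)
Definition rise x := peak (g x) * rE (g x, x) - peak x.

Let Eg x : V x -> E (g x, x).
Proof. by move=> /sink_edge Tx; apply: (conn_sym gT); apply: conn_step (conn_refl T x) Tx. Qed.

Let mpeakg : measurable_fun V2 (peak \o g).
Proof.
apply: (measurable_comp (F := V)) => //; last exact: measurable_funTS.
- by move=> _ [x [_ Vgx] <-].
- exact: measurable_peak.
Qed.

Lemma measurable_rise : measurable_fun V2 rise.
Proof.
apply: measurable_funB; last first.
  by apply: (measurable_funS mV) measurable_peak => x [].
apply: measurable_funM => //; apply: measurable_funTS.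
apply: (measurableT_comp mrE); apply: measurable_fun_pair => //; exact: measurable_id.
Qed.

Lemma up_step x z : V2 x -> up (x, z) -> up (g x, z).
Proof. by case=> Vx Vgx [_ [k /= kz]]; split => //; exists k.+1; rewrite /= kz. Qed.

Lemma rise_ge0 x : V2 x -> 0 <= rise x.
Proof.
move=> V2x; have [Vx Vgx] := V2x; rewrite /rise subr_ge0 rEE; last exact: Eg.
apply: peak_le.
  apply: mulr_ge0; first exact: (ltW (peak_gt0 Vgx)).
  exact: (ltW (rho_gt0 gT hrho (conn_sym gT (Eg Vx)))).
move=> z uxz; have ugz := up_step V2x uxz.
rewrite (rho_trans gT hrho (conn_sym gT (Eg Vx)) (upE uxz)).
rewrite ler_wpM2r ?peak_ub//.
exact: (ltW (rho_gt0 gT hrho (conn_sym gT (Eg Vx)))).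
Qed.

Hypothesis mF : measurable_fun setT F.
Hypothesis F0 : forall x, 0 <= F x.
Hypothesis intF : mu.-integrable setT (EFin \o F).

(** The points [p.2] behind [p.1] at which [F] is at least [e] times the supremum
    behind [g p.1], as seen from [p.2]. *)
Definition loaded (e : R) : set (X * X) :=
  [set p | [/\ V2 p.1, up p & e * (peak (g p.1) * rE (g p.1, p.2)) <= F p.2]].

Lemma measurable_loaded e : measurable (loaded e).
Proof.
pose G (p : X * X) := F p.2 - e * (peak (g p.1) * rE (g p.1, p.2)).
pose D2 : set (X * X) := fst @^-1` V2.
have mD2 : measurable D2.
  by rewrite -[X in measurable X]setTI; exact: measurable_fst.
have mG : measurable_fun D2 G.
  apply: measurable_funB.
    by apply: measurable_funTS; apply: measurableT_comp => //; exact: measurable_snd.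
  apply: measurable_funM; first exact: measurable_cst.
  apply: measurable_funM.
    apply: (measurable_comp (F := V2)) mpeakg _ => //; first by move=> _ [p h <-].
    by apply: measurable_funTS; exact: measurable_fst.
  apply: measurable_funTS; apply: (measurableT_comp mrE).
  apply: measurable_fun_pair; last exact: measurable_snd.
  by apply: measurableT_comp => //; exact: measurable_fst.
rewrite (_ : loaded e = up `&` (D2 `&` G @^-1` `[0, +oo[)); last first.
  apply/seteqP; split=> p; first by case=> V2p upp h; split => //; split => //=; rewrite in_itv /= andbT subr_ge0.
  by case=> upp [V2p]; rewrite /= in_itv /= andbT subr_ge0.
apply: measurableI; first exact: (measurable_upstream sX mg mV).
by apply: mG => //; exact: measurable_itv.
Qed.

Definition flux e : X * X -> \bar R := (fun p => (rise p.1)%:E) \_ (loaded e).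

Lemma measurable_flux e : measurable_fun setT (flux e).
Proof.
apply/(measurable_restrict _ (measurable_loaded e) measurableT); rewrite setTI.
apply/measurable_EFinP; apply: (measurable_comp (F := V2)) measurable_rise _ => //.
  by move=> _ [p [h _ _] <-].
by apply: measurable_funTS; exact: measurable_fst.
Qed.

Lemma flux_ge0 e p : (0 <= flux e p)%E.
Proof. by rewrite /flux patchE; case: ifPn => // /set_mem[/rise_ge0]; rewrite lee_fin. Qed.

Lemma flux_conn e p : flux e p <> 0%E -> E p /\ ~ N p.1.
Proof.
case: p => x y; rewrite /flux patchE; case: ifPn => [/set_mem[V2p upp _] _|_ []//].
by split; [exact: upE|case: upp => /sink_null].
Qed.

(** Let [a k] be the supremum behind the [k]-th point of the forward orbit of [z],
    as seen from [z]. The terms of the sum are increments [a k.+1 - a k] with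
    [a k.+1 <= F z / e], and [a] increases as long as the orbit moves. *)
Lemma flux_telescopes e z : 0 < e ->
  (\esum_(y in setT) (flux e (y, z) * (rho (y, z))%:E) <= (F z / e)%:E)%E.
Proof.
move=> e0; pose o k := iter k g z; pose J := [set k | loaded e (o k, z)].
pose a k := peak (o k) * rho (o k, z).
have E1 : \esum_(y in setT) (flux e (y, z) * (rho (y, z))%:E)%E =
    \esum_(y in o @` J) (rise y * rho (y, z))%:E.
  rewrite [RHS]esum_mkcond; apply: eq_esum => y _; rewrite /flux patchE.
  have -> : ((y, z) \in loaded e) = (y \in o @` J).
    apply/idP/idP => /set_mem h; apply/mem_set.
      by have [_ [_ [k ky]] _] := h; exists k => //; rewrite /J /= /o ky.
    by case: h => k Jk <-.
  by case: ifP; rewrite ?mul0e.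
have injo : set_inj J o.
  move=> i j /set_mem[[Vi _] _ _] /set_mem[[Vj _] _ _] oij.
  exact: (flow_orbit_inj gT aT sink_edge sink_asym sink_back gD gN Vi Vj oij).
have diff k : V2 (o k) -> rise (o k) * rho (o k, z) = a k.+1 - a k.
  move=> V2k; have uk : up (o k, z) by split; [case: V2k|exists k].
  have Vk : V (o k) by case: V2k.
  rewrite /rise mulrBl rEE; last exact: Eg.
  rewrite /a; congr (_ - _); rewrite -mulrA; congr (_ * _).
  exact/esym/(rho_trans gT hrho (conn_sym gT (upE uk)) (conn_sym gT (upE (up_step V2k uk)))).
have mono k : V (o k) -> V (o k.+1) -> a k <= a k.+1.
  move=> Vk Vk1; have V2k : V2 (o k) by [].
  rewrite -subr_ge0 -diff// mulr_ge0 ?rise_ge0//.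
  by apply/ltW/(rho_gt0 gT hrho)/(conn_sym gT)/upE; split => //; exists k.
have K0 : 0 <= F z / e by rewrite divr_ge0// ltW.
pose b n := \sum_(0 <= k < n) (if `[< J k >] then a k.+1 - a k else 0).
(* The second part, that the increments so far have not overtaken [a n], bounds
   their sum by [a n.+1 <= F z / e] after an index [n] in [J]. *)
have bound n : b n <= F z / e /\ (V (o n) -> b n <= a n).
  elim: n => [|n [IH1 IH2]].
    rewrite /b big_geq//; split => // V0; apply: mulr_ge0; first exact: ltW (peak_gt0 V0).
    by rewrite (rho_refl gT hrho).
  rewrite /b big_nat_recr//= -/(b n); case: asboolP => [Jn|nJ].
    have [[Vn Vn1] un le] := Jn.
    have bn : b n + (a n.+1 - a n) <= a n.+1 by rewrite addrCA gerDl subr_le0; exact: IH2.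
    split => //; apply: le_trans bn _; rewrite ler_pdivlMr// mulrC.
    by move: le; rewrite rEE// ; apply: (upE (up_step (conj Vn Vn1) un)).
  rewrite addr0; split => // Vn1.
  have Vn : V (o n).
    by apply: contrapT => nV; apply: (nV); move: Vn1; rewrite /V /o /= (gN nV).
  exact: le_trans (IH2 Vn) (mono _ Vn Vn1).
rewrite E1 esum_image// esum_mkcond -nneseries_esumT; last first.
  move=> k; case: ifPn => // /set_mem[V2k uk _]; rewrite lee_fin mulr_ge0 ?rise_ge0//.
  by apply/ltW/(rho_gt0 gT hrho)/(conn_sym gT)/upE.
apply: lime_le.
  apply: is_cvg_nneseries => k _ _; case: ifPn => // /set_mem[V2k uk _].
  rewrite lee_fin mulr_ge0 ?rise_ge0//.
  by apply/ltW/(rho_gt0 gT hrho)/(conn_sym gT)/upE.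
apply: nearW => n; have [bn _] := bound n; apply: le_trans (_ : (b n)%:E <= _)%E; last by rewrite lee_fin.
rewrite /b -sumEFin; apply: lee_sum => k _.
have -> : (k \in J) = `[< J k >] by [].
by case: asboolP => // Jk; rewrite diff//; case: Jk.
Qed.

Lemma flux_finite e : 0 < e ->
  mu.-negligible [set x | ~ (\esum_(y in setT) flux e (x, y) < +oo)%E].
Proof.
move=> e0.
have mf := measurable_class_esum sX mphi phiE mN (measurable_flux e) (flux_ge0 e) (@flux_conn e).
apply: ae_lty => //; first by move=> x; apply: esum_ge0 => y _; exact: flux_ge0.
rewrite (mass_transport mE hrho (measurable_flux e) (flux_ge0 e)); last 2 first.
- by move=> p /flux_conn[].
- exact: conn_sym.
apply: (@le_lt_trans _ _ (\int[mu]_x ((e^-1)%:E * (EFin \o F) x))%E).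
  apply: ge0_le_integral => //.
  - move=> x _; apply: esum_ge0 => y _; have := flux_ge0 e (y, x).
    have [->|/eqP/flux_conn[xy _] h] := eqVneq (flux e (y, x)) 0%E; first by rewrite mul0e.
    by apply: mule_ge0 => //; rewrite lee_fin; apply/ltW/(rho_gt0 gT hrho)/(conn_sym gT).
  - apply: (measurable_class_esum sX mphi phiE mN
       (h := fun p => (flux e (p.2, p.1) * (rho (p.2, p.1))%:E)%E)).
    + apply: (measurable_swapped mE hrho) => //; first exact: measurable_flux.
      by move=> p /flux_conn[].
    + move=> [x y] /=; have := flux_ge0 e (y, x).
      have [->|/eqP/flux_conn[xy _] h] := eqVneq (flux e (y, x)) 0%E; first by rewrite mul0e.
      by apply: mule_ge0 => //; rewrite lee_fin; apply/ltW/(rho_gt0 gT hrho)/(conn_sym gT).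
    + move=> [x y] /=.
      have [->|/eqP/flux_conn[/= xy ny] _] := eqVneq (flux e (y, x)) 0%E; first by rewrite mul0e.
      by split; [exact: conn_sym|exact: (outside_class gT NN xy ny)].
  - by apply: emeasurable_funM => //; exact/measurable_EFinP.
  - move=> x _; rewrite /= -EFinM mulrC; exact: flux_telescopes.
rewrite ge0_integralZl//.
- by apply: lte_mul_pinfty; rewrite ?lee_fin ?invr_ge0 ?ltW//; exact: integrable_lty intF.
- exact/measurable_EFinP.
- by move=> x _; rewrite lee_fin.
- by rewrite lee_fin invr_ge0 ltW.
Qed.

(** If infinitely many [z] of the side had [eps <= rhon (z, x)], they would all be
    loaded for a small [e], and the sum of [rise x > 0] over them would diverge. *)
Lemma fall_finite (rhon : X * X -> R) x y t eps :
  (forall z, E (x, z) -> rhon (z, x) * F x = F z * rho (z, x)) -> F x <> 0 ->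
  (forall k, (\esum_(z in setT) flux k.+1%:R^-1 (x, z) < +oo)%E) ->
  ~ N x -> T (x, y) -> T (y, t) -> x <> t -> below y (side T y t) -> falls x y t ->
  0 < eps -> finite_set [set z | side T x y z /\ eps <= rhon (z, x)].
Proof.
move=> coh /eqP Fx fin nx Txy Tyt xt bel [u [m [yu fall]]] eps0.
have Exy : E (x, y) by exact: conn_step (conn_refl T x) Txy.
have syt : sink y t by split => //; exact: (outside_class gT NN Exy nx).
have sxy : sink x y := sink_back syt Txy xt.
have gx := gD sxy; have gy := gD syt.
have Vx : V x by rewrite /V /= gx.
have Vy : V y by rewrite /V /= gy.
have V2x : V2 x by split => //=; rewrite gx.
have sides a : V a -> [set z | up (a, z)] = side T a (g a).
  exact: (upstream_side gT aT sink_edge sink_asym sink_back gD gN).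
have upx z : up (x, z) <-> side T x y z by rewrite -[in X in _ <-> X]gx -(sides _ Vx).
have upy z : up (y, z) <-> side T y t z by rewrite -[in X in _ <-> X]gy -(sides _ Vy).
have Exu : E (x, u) by apply: conn_trans Exy (side_conn yu).
have ryx0 : 0 < rho (y, x) := rho_gt0 gT hrho Exy.
have rux0 : 0 < rho (u, x) := rho_gt0 gT hrho Exu.
have py0 := peak_gt0 Vy.
have rise_gt0 : 0 < rise x.
  rewrite /rise gx subr_gt0 rEE; last exact: (conn_sym gT).
  apply: (@le_lt_trans _ _ ((1 - m.+1%:R^-1) * rho (u, x))).
    apply: peak_le.
      rewrite mulr_ge0 ?(ltW rux0)// subr_ge0 invf_le1// ?ler1n//.
    move=> z uxz; rewrite (rho_trans gT hrho Exu (upE uxz)).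
    by rewrite ler_wpM2r ?(ltW rux0)//; apply: fall; apply/upx.
  apply: (@lt_le_trans _ _ (rho (u, x))).
    by rewrite gtr_pMl// oneB_natinv_lt1.
  rewrite (rho_trans gT hrho Exy Exu) ler_wpM2r ?(ltW ryx0)//.
  by apply: peak_ub; apply/upy.
have Fx0 : 0 < F x by rewrite lt_neqAle eq_sym Fx F0.
have K0 : 0 < eps * F x / (peak y * rho (y, x)) by rewrite divr_gt0 ?mulr_gt0.
have [k hk] := ltr_add_invr K0; rewrite add0r in hk.
apply: contrapT => inf; have := fin k; rewrite ltNge => /negP; apply.
have infW : infinite_set [set z | loaded k.+1%:R^-1 (x, z)].
  apply: contra_not inf; apply: sub_finite_set => z [xz ez].
  have uxz := (upx z).2 xz; have Exz := upE uxz.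
  have rzx0 : 0 < rho (z, x) := rho_gt0 gT hrho Exz.
  split => //=; rewrite gx rEE; last exact: conn_trans (conn_sym gT Exy) Exz.
  rewrite (rho_trans gT hrho (conn_sym gT Exz) (conn_trans (conn_sym gT Exz) Exy)).
  rewrite (rho_inv gT hrho Exz) mulrA mulrA -ler_pdivlMr ?invr_gt0// invrK -coh//.
  apply: (@le_trans _ _ (eps * F x)); last by rewrite ler_wpM2r// ltW.
  rewrite -mulrA -ler_pdivlMr ?mulr_gt0//; exact: ltW.
rewrite -(esum_infinite rise_gt0 infW) [leLHS]esum_mkcond; apply: le_esum => z _.
rewrite /flux patchE.
have -> : (z \in [set z | loaded k.+1%:R^-1 (x, z)]) = ((x, z) \in loaded k.+1%:R^-1).
  by apply/idP/idP => /set_mem h; exact/mem_set.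
by [].
Qed.

End drop.

(** * One cocycle controls the other *)

(** What is needed of a vertex to pass from [rhom] to [rhon]; the first part serves
    barytropic ends and the core, the second part nonvanishing ends. *)
Definition controls (R : realType) (d : measure_display) (X : measurableType d)
    (T : set (X * X)) (rhom rhon : X * X -> R) (x : X) :=
  (forall y, T (x, y) -> (mass rhom x (side T x y) < +oo)%E ->
     (mass rhon x (side T x y) < +oo)%E) /\
  (forall y t eps, T (x, y) -> T (y, t) -> x <> t -> below T rhom y (side T y t) ->
     falls T rhom x y t -> 0 < eps ->
     finite_set [set z | side T x y z /\ eps <= rhon (z, x)]).

Lemma controls_ae (R : realType) (d : measure_display) (X : measurableType d)
    (T : set (X * X)) (mu nu : probability X R) (rhom rhon : X * X -> R) :
  standard_borel R X -> is_graph T -> acyclic T -> measurable T -> locally_countable T ->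
  mcp (conn_rel T) mu -> nu `<< mu -> mu `<< nu ->
  RN_cocycle (conn_rel T) mu rhom -> RN_cocycle (conn_rel T) nu rhon ->
  mu.-negligible [set x | ~ controls T rhom rhon x].
Proof.
move=> sX gT aT mT lc mcpmu numu munu hm hn.
have mE : measurable (conn_rel T) by case: hm => -[].
have [phi [N [mphi Ephi phiE mN [N0 NN]]]] := class_enumeration sX gT lc mE mcpmu.
have B := side_mass_finite sX gT aT mT mphi Ephi phiE mN NN hm hn numu.
have [F [mF F0 intF Fnu F00]] := density numu munu.
have [g [mg gD gN mV]] := flow_map mphi phiE
  (measurable_sink sX gT mT mphi Ephi phiE mN hm) (@sink_null _ _ _ T N rhom)
  (@sink_edge _ _ _ T N rhom) (sink_uniq gT aT hm).
have coh := cocycle_change sX gT mphi Ephi phiE mN NN hm hn mF F0 Fnu.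
have fl k : mu.-negligible [set x | ~ (\esum_(y in setT) flux T phi N rhom F g k.+1%:R^-1 (x, y) < +oo)%E].
  apply: (flux_finite sX gT aT mphi Ephi phiE mN NN hm mg gD gN mV mF F0 intF).
  by rewrite invr_gt0.
have negN : mu.-negligible N by apply/negligibleP.
apply: negligibleS (negligibleU (negligibleU negN (dominates_negligible munu B))
  (negligibleU F00 (negligibleU coh (negligible_bigcup fl)))) => x nc.
apply: contrapT => bad; apply: nc.
have nx : ~ N x by move=> h; apply: bad; left; left.
split=> [y Txy fm|y t eps Txy Tyt xt bel fal eps0].
  by apply: contrapT => fn; apply: bad; left; right; exists y.
apply: (fall_finite gT aT phiE NN hm gD gN F0 (rhon := rhon)) Txy Tyt xt bel fal eps0 => //.
- move=> z xz; apply: contrapT => ne; apply: bad; right; right; left.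
  by split => //; exists z.
- by move=> Fx; apply: bad; right; left.
- by move=> k; apply: contrapT => ni; apply: bad; right; right; right; exists k.
Qed.

(** * Ends and their neighbourhoods *)
Section ends.
Context (R : realType) (d : measure_display) (X : measurableType d).
Context (T : set (X * X)).
Hypotheses (gT : is_graph T) (aT : acyclic T).
Local Notation E := (conn_rel T).

Lemma end_ray (xi : graph_end T) r : sval xi r -> geodesic_ray T r.
Proof. by case: xi => S [r0 ray0 SE] /=; rewrite SE => -[]. Qed.

Lemma end_common_tail (xi : graph_end T) r s : sval xi r -> sval xi s -> common_tail r s.
Proof.
case: xi => S [r0 ray0 SE] /=; rewrite SE => -[_ [m [n h]]] [_ [m' [n' h']]].
exists (n + m')%N, (n' + m)%N => k.
by rewrite -!addnA -h -h' !addnA (addnC m).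
Qed.

Lemma end_eventually (xi : graph_end T) r U : sval xi r -> end_closure T U (inr xi) ->
  exists m, forall n, (m <= n)%N -> U (r n).
Proof.
move=> hr [s hs sU]; have [m [n h]] := end_common_tail hr hs.
exists m => k mk; rewrite -(subnKC mk) h; apply: sU; by eexists.
Qed.

Lemma end_closure_tail (xi : graph_end T) r m U : sval xi r ->
  (forall n, (m <= n)%N -> U (r n)) -> end_closure T U (inr xi).
Proof.
case: xi => S [r0 ray0 SE] /=; rewrite SE => -[[ir er] [a [b h]]] Ur.
exists (fun k => r (m + k)%N); last by move=> _ [k _ <-]; apply: Ur; exact: leq_addr.
split; last first.
  exists (a + m)%N, b => k; rewrite -addnA h; congr r; lia.
split; first by move=> i j /ir; lia.
by move=> n; rewrite addnS.
Qed.

Variable xi : graph_end T.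
Variable r : nat -> X.
Hypothesis hr : sval xi r.
Let ray := end_ray hr.

(** The sides along a ray form a base of the neighbourhoods of its end, together
    with [side_end_nbhs]. *)
Lemma end_nbhs_ray V : end_nbhs xi V ->
  \forall n \near \oo, side T (r n.+1) (r n) `<=` V.
Proof.
pose G : set_system X := [set A | \forall n \near \oo, side T (r n.+1) (r n) `<=` A].
have GF : Filter G.
  split; first by exists 0%N.
    move=> A B [k _ hk] [l _ hl]; exists (maxn k l) => // n /=.
    rewrite geq_max => /andP[kn ln] z sz.
    by split; [exact: (hk n kn)|exact: (hl n ln)].
  by move=> A B AB [k _ hk]; exists k => // n kn; exact: subset_trans (hk n kn) AB.
case=> A [D DU <-] AV; suff : G V by [].
apply: (@filterS _ G GF _ _ AV); apply: (@filter_bigI _ _ D id G GF) => U UD; have [hU cU] := set_mem (DU U UD).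
have [m hm] := end_eventually hr cU.
have [k hk] := ray_half_space gT aT ray hU hm.
by exists k.
Qed.

Lemma side_end_nbhs n : end_nbhs xi (side T (r n.+1) (r n)).
Proof.
exists (side T (r n.+1) (r n)) => //; apply: finI_from1; split.
  by apply: (side_half_space gT aT); apply: (graph_sym gT); exact: ray.2.
apply: (end_closure_tail (m := n.+1) hr) => k nk; rewrite -(subnKC nk).
exact: ray_side_tail.
Qed.

End ends.

(** * Transfer of vanishing and of infinite mass *)
Section transfer.
Context (R : realType) (d : measure_display) (X : measurableType d).
Context (T : set (X * X)) (mu nu : probability X R) (rhom rhon : X * X -> R).
Hypotheses (gT : is_graph T) (aT : acyclic T).
Hypothesis hm : RN_cocycle (conn_rel T) mu rhom.
Hypothesis hn : RN_cocycle (conn_rel T) nu rhon.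
Variable Z : set X.
Hypothesis ctl : forall x, ~ Z x -> controls T rhom rhon x.
Local Notation E := (conn_rel T).

Lemma vanishing_along_ray (xi : graph_end T) r x0 : sval xi r ->
  ereal_inf [set ereal_sup [set (rhom (y, x0))%:E | y in V] | V in end_nbhs xi] = 0%E ->
  forall e : R, 0 < e -> exists k, forall n, (k <= n)%N ->
    forall z, side T (r n.+1) (r n) z -> rhom (z, x0) <= e.
Proof.
move=> hr inf0 e e0.
have : (ereal_inf [set ereal_sup [set (rhom (y, x0))%:E | y in V] | V in end_nbhs xi] < e%:E)%E.
  by rewrite inf0 lte_fin.
move=> /ereal_inf_lt[_ [V VE <-] Ve].
have [k _ hk] := end_nbhs_ray gT aT hr VE.
exists k => n kn z sz; rewrite -lee_fin; apply: le_trans (ltW Ve).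
by apply: ereal_sup_ubound; exists z => //; exact: (hk n kn).
Qed.

(** The suprema over the sides along the ray tend to zero. If they never dropped
    from some point on, values arbitrarily close to [rhom (u0, u0) = 1] would be
    attained on all later sides. *)
Lemma vanishing_falls (xi : graph_end T) r x0 : sval xi r -> E (x0, r 0%N) ->
  ereal_inf [set ereal_sup [set (rhom (y, x0))%:E | y in V] | V in end_nbhs xi] = 0%E ->
  exists n, below T rhom (r n.+1) (side T (r n.+1) (r n)) /\
    falls T rhom (r n.+2) (r n.+1) (r n).
Proof.
move=> hr x0r inf0; have ray := end_ray hr.
have small := vanishing_along_ray hr inf0.
have con n : E (x0, r n) by apply: conn_trans x0r (ray_conn gT ray 0 n).
have scon n z : side T (r n.+1) (r n) z -> E (x0, z).
  by move=> /side_conn; apply: conn_trans.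
have half u : E (x0, u) -> exists k, forall n, (k <= n)%N ->
    forall z, side T (r n.+1) (r n) z -> rhom (z, u) <= 1 - 2%:R^-1.
  move=> x0u; have u0 := rho_gt0 gT hm x0u.
  have [|k hk] := small (rhom (u, x0) / 2); first by rewrite divr_gt0.
  exists k => n kn z sz; have := hk n kn z sz.
  rewrite (rho_trans gT hm x0u (scon _ _ sz)) mulrC ler_pM2l// => h.
  by apply: le_trans h _; lra.
have [k1 hk1] := half _ (con 0%N).
have bel n : (k1 <= n)%N -> below T rhom (r n.+1) (side T (r n.+1) (r n)).
  move=> kn; exists (r 0%N), 1%N; split; first exact: ray_conn.
  exact: hk1.
apply: contrapT => nofall.
have nf n u m : (k1 <= n)%N -> side T (r n.+1) (r n) u ->
    exists2 z, side T (r n.+2) (r n.+1) z & 1 - m.+1%:R^-1 < rhom (z, u).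
  move=> kn su; apply: contrapT => h; apply: nofall; exists n; split; first exact: bel.
  exists u, m; split => // z sz; rewrite leNgt; apply/negP => lt; apply: h; by exists z.
pose u0 := r k1.+1.
have high k : forall de : R, 0 < de < 1 ->
    exists2 z, side T (r (k1 + k).+1) (r (k1 + k)%N) z & de < rhom (z, u0).
  elim: k => [|k IH] de /andP[de0 de1].
    by exists u0; rewrite ?addn0; [exact: side_refl|rewrite (rho_refl gT hm)].
  have [|z sz hz] := IH ((1 + de) / 2); first by apply/andP; split; lra.
  (* The loss factor [1 - m.+1%:R^-1] must keep the product above [de]. *)
  have q1 : 0 < 1 - de / ((1 + de) / 2).
    rewrite subr_gt0 ltr_pdivrMr; lra.
  have [m hm'] := ltr_add_invr q1; rewrite add0r in hm'.
  have [z' sz' hz'] := nf (k1 + k)%N z m (leq_addr _ _) sz.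
  exists z'; first by rewrite addnS.
  have c0 : E (u0, z) by apply: conn_trans (conn_sym gT (con _)) (scon _ _ sz).
  have c1 : E (u0, z') by apply: conn_trans (conn_sym gT (con _)) (scon _ _ sz').
  rewrite (rho_trans gT hm c0 c1).
  have lt1 : de / ((1 + de) / 2) < rhom (z', z).
    by apply: lt_trans hz'; rewrite ltrBrDr addrC -ltrBrDr.
  have e1 : de = de / ((1 + de) / 2) * ((1 + de) / 2).
    by rewrite mulfVK//; apply: lt0r_neq0; lra.
  rewrite [ltLHS]e1; apply: ltr_pM lt1 hz; last by lra.
  by apply: divr_ge0; lra.
have [k hk] := half _ (con k1.+1).
have [|z sz hz] := high k (2%:R^-1); first by apply/andP; split; lra.
have := hk (k1 + k)%N (leq_addl _ _) z sz.
by rewrite -/u0; lra.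
Qed.

(** Beyond an edge at which the supremum falls, [rhon] exceeds [e] at finitely many
    vertices only, and the ray's sides leave each of them behind. *)
Lemma vanishing_transfer (xi : graph_end T) : end_closure T (~` Z) (inr xi) ->
  rho_vanishing rhom xi -> rho_vanishing rhon xi.
Proof.
move=> [r hr rZ] [x0 x0xi inf0]; have ray := end_ray hr.
have [m0 hm0] := end_eventually hr x0xi.
have x0r : E (x0, r 0%N).
  by apply: conn_trans (hm0 m0 (leqnn _)) _; exact: ray_conn.
have [n [bel fal]] := vanishing_falls hr x0r inf0.
have Te k : T (r k.+1, r k) by apply: (graph_sym gT); exact: ray.2.
have [_ fin] := ctl (rZ _ (ex_intro2 _ _ n.+2 I erefl)).
have ne : r n.+2 <> r n by move=> /ray.1 e; have : n.+2 = n := e; lia.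
exists (r n.+2).
  by exists r => // _ [k _ <-]; exact: ray_conn.
apply/eqP; rewrite eq_le; apply/andP; split.
  apply/lee_addgt0Pr => e e0; rewrite add0e.
  have finB := fin _ _ _ (Te _) (Te _) ne bel fal e0.
  have [B BE] := (finite_seqP _).1 finB.
  have [k hk] : exists k, forall i, (k <= i)%N -> forall b, b \in B -> ~ side T (r i.+1) (r i) b.
    have : forall b, b \in B -> side T (r n.+2) (r n.+1) b.
      by move=> b bB; have : [set` B] b by []; rewrite -BE => -[].
    elim: B {BE} => [|c B IH] sB; first by exists 0%N.
    have [|k hk] := IH; first by move=> b bB; apply: sB; rewrite inE bB orbT.
    have [|m hm'] := ray_side_escape gT aT ray (b := c).
      apply: conn_trans (ray_conn gT ray 0 n.+2) _; apply: (@side_conn _ T _ (r n.+1)).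
      by apply: sB; rewrite inE eqxx.
    exists (maxn k m) => i; rewrite geq_max => /andP[ki mi] b; rewrite inE => /orP[/eqP ->|].
      exact: hm'.
    exact: hk.
  pose m := maxn k n.+1.
  apply: (@le_trans _ _ (ereal_sup [set (rhon (y, r n.+2))%:E | y in side T (r m.+1) (r m)])).
    apply: ereal_inf_lbound; exists (side T (r m.+1) (r m)) => //.
    exact: side_end_nbhs.
  apply: ge_ereal_sup => _ [z sz <-]; rewrite lee_fin leNgt; apply/negP => lt.
  have sz' : side T (r n.+2) (r n.+1) z by apply: (ray_side_decr gT aT ray (leq_maxr k n.+1)).
  apply: (hk m (leq_maxl _ _) z) => //.
  have : [set z | side T (r n.+2) (r n.+1) z /\ e <= rhon (z, r n.+2)] z by split => //; exact: ltW.
  by rewrite BE.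
apply: le_ereal_inf_tmp => _ [V VE <-].
have [k _ hk] := end_nbhs_ray gT aT hr VE.
apply: (@le_trans _ _ (rhon (r k.+1, r n.+2))%:E).
  by rewrite lee_fin ltW// (rho_gt0 gT hn)//; exact: ray_conn.
by apply: ereal_sup_ubound; exists (r k.+1) => //; apply: (hk k (leqnn k)); exact: side_refl.
Qed.

Lemma rho_infinite_transfer U : half_space T U -> U `<=` ~` Z ->
  rho_infinite E rhon U -> rho_infinite E rhom U.
Proof.
move=> hU UZ [x Ux infn]; case: (hU) => cU [[a b] [/= [Tab Ua nUb] _]].
have UE := half_space_side hU Tab Ua nUb.
exists a; first by rewrite UE; exact: side_conn.
apply: contrapT => nfin.
have fm : (mass rhom a (side T a b) < +oo)%E.
  by rewrite -UE ltey; apply/eqP.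
have [ctl1 _] := ctl (UZ _ Ua).
have := mass_fin_base gT hn (@side_conn _ T a b) (conn_sym gT (Ux _ Ua)) (ctl1 _ Tab fm).
by rewrite -UE /mass infn.
Qed.

End transfer.

Theorem theorem9p8 (R : realType) (d : measure_display) (X : measurableType d)
    (hX : standard_borel R X)
    (T : set (X * X)) (hT : is_graph T) (mT : measurable T)
    (hlc : locally_countable T) (hac : acyclic T)
    (C : set (probability X R)) (hC : measure_class C)
    (hinv : forall la : probability X R, C la -> mcp (conn_rel T) la)
    (mu nu : probability X R) (hmu : C mu) (hnu : C nu)
    (rho_mu rho_nu : X * X -> R)
    (hrho_mu : RN_cocycle (conn_rel T) mu rho_mu)
    (hrho_nu : RN_cocycle (conn_rel T) nu rho_nu) :
  exists N : set X,
    [/\ measurable N, saturation (conn_rel T) N = N,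
        forall la : probability X R, C la -> la N = 0%E &
    [/\ forall xi : graph_end T, end_closure T (~` N) (inr xi) ->
          (rho_nonvanishing rho_mu xi <-> rho_nonvanishing rho_nu xi),
        forall xi : graph_end T, end_closure T (~` N) (inr xi) ->
          (rho_barytropic rho_mu xi <-> rho_barytropic rho_nu xi) &
        end_closure T (~` N) `&` core T rho_mu =
        end_closure T (~` N) `&` core T rho_nu]].
Proof.
have munu := hC _ _ hmu hnu; have numu := hC _ _ hnu hmu.
have Z1 := controls_ae hX hT hac mT hlc (hinv _ hmu) numu munu hrho_mu hrho_nu.
have Z2 := controls_ae hX hT hac mT hlc (hinv _ hnu) munu numu hrho_nu hrho_mu.
have [N [mN N0 ZN NN]] := null_saturation (@conn_refl _ T)
  (fun x y z => @conn_trans _ T x y z) (hinv _ hmu)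
  (negligibleU Z1 (dominates_negligible munu Z2)).
have c1 x : ~ N x -> controls T rho_mu rho_nu x.
  by move=> nx; apply: contrapT => h; apply: nx; apply: ZN; left.
have c2 x : ~ N x -> controls T rho_nu rho_mu x.
  by move=> nx; apply: contrapT => h; apply: nx; apply: ZN; right.
have UN U z : half_space T U -> end_closure T U z -> end_closure T (~` N) z -> U `<=` ~` N.
  move=> hU Uz Nz; have [v Uv nv] : exists2 v, U v & ~ N v.
    case: z Uz Nz => [x Ux Nx|xi Uxi [r hr rN]]; first by exists x.
    have [m hm] := end_eventually hr Uxi.
    by exists (r m); [exact: hm|apply: rN; exists m].
  move=> u Uu; apply: (outside_class hT NN) nv.
  have [s [ps ls]] := hU.1 _ _ Uv Uu; exists s; split => //.
  by apply: sub_path ps => a b /set_mem[Tab _]; exact/mem_set.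
exists N; split => //.
  move=> la hla; have /null_content_dominatesP := hC _ _ hla hmu.
  by apply.
have inf12 U z : half_space T U -> end_closure T U z -> end_closure T (~` N) z ->
    (rho_infinite (conn_rel T) rho_mu U <-> rho_infinite (conn_rel T) rho_nu U).
  move=> hU Uz Nz; have sU := UN _ _ hU Uz Nz; split.
    exact: (rho_infinite_transfer hT hrho_mu c2 hU sU).
  exact: (rho_infinite_transfer hT hrho_nu c1 hU sU).
split.
- move=> xi Nxi; split; apply: contra_not.
    exact: (vanishing_transfer hT hac hrho_nu hrho_mu c2).
  exact: (vanishing_transfer hT hac hrho_mu hrho_nu c1).
- by move=> xi Nxi; split=> h U hU Uxi; apply/(inf12 _ _ hU Uxi Nxi)/h.
- apply/seteqP; split=> z [Nz h]; split => // U hU Uz;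
    by apply/(inf12 _ _ hU Uz Nz)/h.
Qed.
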